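(* Let $(R,\Phi)$ be a form ring and let $\rho=(V,\rho_M,\rho_\Phi,\beta)$ be a finite representation of $(R,\Phi)$ with conductor $f=f(\rho)$, such that for some $N_0\ge 1$ there is a self-dual isotropic code in $\rho^{(1,\ldots,1)}$ ($N_0$ ones). Assume that the Weight Enumerator Conjecture holds for $(R,\Phi)$. Let $K=K(\rho)$, $F$, and $\Gamma=\mathrm{Gal}(K/F)=\{\alpha_1,\ldots,\alpha_n\}$ be as defined in the context. Let ${\bf a}=(a_1,\ldots,a_N)$ be a tuple of integers prime to $f$ satisfying the sign condition, and let ${\bf d}=(d_1,\ldots,d_n)$ with $d_j=|\{i\in\{1,\ldots,N\}\mid \gamma_{a_i}=\alpha_j\}|$. Then the space of invariants of the Clifford-Weil group $\mathcal C(\rho)$ in $K[{\bf x}\circ\Gamma]_{\bf d}$ is spanned over $K$ by the $\Gamma$-conjugate complete weight enumerators $\mathrm{ccwe}^{\bf a}(C)$ of the self-dual isotropic codes $C$ in $\rho^{\bf a}$.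
   Context: **Form rings.** For a ring $R$ (unital, associative), an $R$-qmodule is an abelian group $\Phi$ with a map $[\,]:R\to\mathrm{End}_{\mathbb Z}(\Phi)$ (written on the right, $\phi\mapsto\phi[r]$) that is pointed quadratic ($[0]=0$ and $(r,s)\mapsto[r+s]-[r]-[s]$ is biadditive) with $[1]=1$, $[rs]=[r][s]$. A right $R\otimes R$-module $M$ is a qmodule via $m[r]=m(r\otimes r)$; qmodule homomorphisms are additive maps commuting with all $[r]$. A form ring $(R,M,\psi,\Phi)$ consists of a ring $R$, a right $R\otimes R$-module $M$, an isomorphism of right $R$-modules $\psi:R_R\to M_{1\otimes R}$, an additive involution $\tau:M\to M$ with $\tau(m)(s\otimes r)=\tau(m(r\otimes s))$ such that $\psi^{-1}(\tau(\psi(1)))$ is a unit of $R$, an $R$-qmodule $\Phi$, and qmodule homomorphisms $\{\!\{\ \}\!\}:M\to\Phi$, $\lambda:\Phi\to M$ with $\{\!\{\tau(m)\}\!\}=\{\!\{m\}\!\}$, $\tau(\lambda(\phi))=\lambda(\phi)$, $\lambda(\{\!\{m\}\!\})=m+\tau(m)$, $\{\!\{\lambda(\phi)(r\otimes s)\}\!\}=\phi[r+s]-\phi[r]-\phi[s]$. It is abbreviated $(R,\Phi)$. The map $r^J:=\psi^{-1}(\psi(1)(r\otimes1))$ is an anti-automorphism of $R$. **Representations.** A finite representation $\rho=(V,\rho_M,\rho_\Phi,\beta)$ of $(R,\Phi)$ consists of a finite left $R$-module $V$; an $R\otimes R$-module homomorphism $\rho_M$ from $M$ to the group $\mathrm{Bil}(V)$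 of biadditive maps $V\times V\to\mathbb Q/\mathbb Z$ (where $(b(r\otimes s))(x,y)=b(rx,sy)$) with $\rho_M(\tau(m))(x,y)=\rho_M(m)(y,x)$ and such that $\beta:=\rho_M(\psi(1))$ is non-singular; and a qmodule homomorphism $\rho_\Phi$ from $\Phi$ to the group of $\mathbb Q/\mathbb Z$-valued (pointed) quadratic maps on $V$ (where $(q[r])(x)=q(rx)$) with $\rho_\Phi(\{\!\{m\}\!\})(x)=\rho_M(m)(x,x)$ and $\rho_M(\lambda(\phi))(x,y)=\rho_\Phi(\phi)(x+y)-\rho_\Phi(\phi)(x)-\rho_\Phi(\phi)(y)$. The conductor $f(\rho)$ is the order of the (finite cyclic) subgroup of $\mathbb Q/\mathbb Z$ generated by all $\beta(x,y)$ and all $\rho_\Phi(\phi)(x)$. **Codes.** A code in $\rho$ is an $R$-submodule $C\le V$; $C^\perp=\{x\in V\mid\beta(x,c)=0\ \forall c\in C\}$; $C$ is self-dual if $C=C^\perp$; a code $C\subseteq C^\perp$ is isotropic if $\rho_\Phi(\phi)(C)=\{0\}$ for all $\phi\in\Phi$. A code of Type $\rho$ is a self-dual isotropic code in $\rho$. **Sums.** For ${\bf a}=(a_1,\ldots,a_N)$ with all $a_i\in\mathbb Z$ prime to $f(\rho)$, $\rho^{\bf a}$ is the finite representation of $(R,\Phi)$ on $V^N$ given by $m\mapsto\big((x,y)\mapsto\sum_i a_i\rho_M(m)(x_i,y_i)\big)$, $\phi\mapsto\big(x\mapsto\sum_i a_i\rho_\Phi(\phi)(x_i)\big)$ and the form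 $\sum_i a_i\beta(x_i,y_i)$. **Clifford-Weil group.** An idempotent $\iota\in R$ is symmetric if $\iota R\cong\iota^JR$ as right $R$-modules; then one fixes $v_\iota\in\iota^JR\iota$, $u_\iota\in\iota R\iota^J$ with $u_\iota v_\iota=\iota$, $v_\iota u_\iota=\iota^J$. For a finite representation $\rho$ on $V$, let $\mathbb CV$ have basis $(b_w:w\in V)$. The Clifford-Weil group $\mathcal C(\rho)$ is the group of linear operators on $\mathbb CV$ generated by $m_r:b_w\mapsto b_{rw}$ ($r\in R^\times$), $d_\phi:b_w\mapsto\exp(2\pi i\rho_\Phi(\phi)(w))\,b_w$ ($\phi\in\Phi$), and $h_{\iota,u_\iota,v_\iota}:b_w\mapsto|\iota V|^{-1/2}\sum_{u\in\iota V}\exp(2\pi i\beta(u,v_\iota w))\,b_{u+(1-\iota)w}$, where $\iota$ runs through representatives of the $R^\times$-conjugacy classes of symmetric idempotents of $R$. **Weight Enumerator Conjecture.** For a code $C$ in $\rho$ let $\mathrm{fwe}(C)=\sum_{c\in C}b_c\in\mathbb CV$. The Weight Enumerator Conjecture holds for $(R,\Phi)$ if for every finite representation $\rho'$ of $(R,\Phi)$, with underlying module $V'$, the subspace of $\mathbb CV'$ fixed by $\mathcal C(\rho')$ is spanned by the $\mathrm{fwe}(C)$, $C$ a code of Type $\rho'$. **Fields and signs.** Put $f=f(\rho)$, $\zeta_f=\exp(2\pi i/f)$, $F_1=\mathbb Q(\{\sqrt{|\iota V|}:\iota\in R\text{ symmetric idempotent}\})$, $K=K(\rho)=\mathbb Q(\zeta_f)F_1$.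 Choose a complement $F$ of $F_1\cap\mathbb Q(\zeta_f)$ in $F_1$ (a subfield $F\le F_1$ with $F\cdot(F_1\cap\mathbb Q(\zeta_f))=F_1$ and $F\cap\mathbb Q(\zeta_f)=\mathbb Q$). For $a$ prime to $f$, $\gamma_a\in\mathrm{Gal}(K/F)$ is the automorphism that is the identity on $F$ with $\gamma_a(\zeta_f)=\zeta_f^a$; $a\mapsto\gamma_a$ is an isomorphism $(\mathbb Z/f\mathbb Z)^\times\to\Gamma:=\mathrm{Gal}(K/F)=\{\alpha_1,\ldots,\alpha_n\}$. Define $\epsilon(\iota,a)\in\{1,-1\}$ by $\gamma_a(\sqrt{|\iota V|})=\epsilon(\iota,a)\sqrt{|\iota V|}$. The tuple ${\bf a}$ satisfies the sign condition if $\prod_{i=1}^N\epsilon(\iota,a_i)=1$ for all symmetric idempotents $\iota\in R$. **Conjugate polynomials and weight enumerators.** Let $v=|V|$ and let $x_w$ ($w\in V$) be the coordinate functions on $K^V\cong K^v$. $K[{\bf x}\circ\Gamma]$ is the $K$-algebra of functions $K^V\to K$ spanned by the monomials $\prod_{j=1}^n\prod_{w\in V}(x_w\circ\alpha_j)^{m_{wj}}$, where $(x_w\circ\alpha_j)(k)=\alpha_j(k_w)$; such a monomial has degree $(d_1,\ldots,d_n)$, $d_j=\sum_wm_{wj}$, and $K[{\bf x}\circ\Gamma]_{\bf d}$ is the span of the monomials of degree ${\bf d}$. An element $g\in\mathcal C(\rho)$, $g:b_w\mapsto\sum_ug_{uw}b_u$, is identified with the matrix $(g_{uw})\in\mathrm{GL}_v(K)$,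 acting on row vectors in $K^V$ from the right, and on functions by $(f\cdot g)(k)=f(kg^{-1})$; invariants are the functions fixed by all $g\in\mathcal C(\rho)$. With $D_j=\{i\in\{1,\ldots,N\}\mid\gamma_{a_i}=\alpha_j\}$ and $d_j=|D_j|$, the $\Gamma$-conjugate complete weight enumerator of a code $C\le V^N$ in $\rho^{\bf a}$ is $\mathrm{ccwe}^{\bf a}(C)=\sum_{c\in C}\prod_{j=1}^n\prod_{i\in D_j}x_{c_i}\circ\alpha_j\in K[{\bf x}\circ\Gamma]_{\bf d}$. *)

(* Defs.v *)
From HB Require Import structures.
From mathcomp Require Import all_boot all_order all_fingroup all_algebra all_field.
From mathcomp Require Import ring_quotient generic_quotient finmap complex.
From mathcomp Require Import classical_sets functions cardinality reals trigo.

Set Implicit Arguments.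
Unset Strict Implicit.
Unset Printing Implicit Defensive.

Import Order.TTheory GRing.Theory Num.Theory.

Local Open Scope ring_scope.
Local Open Scope complex_scope.

(* Gives {ffun I -> V} its finLmodType structure. *)
HB.saturate finfun_of.

(* The additive group Q/Z. *)
Definition QZ :=
  Quotient.quot (GRing.ZmodClosed.clone rat (@Num.int_num_subdef rat) _).

Definition biadditive (U V W : zmodType) (f : U -> V -> W) : Prop :=
  (forall x x' y, f (x + x') y = f x y + f x' y) /\
  (forall x y y', f x (y + y') = f x y + f x y').

Definition pointed_quadratic (U W : zmodType) (q : U -> W) : Prop :=
  q 0 = 0 /\ biadditive (fun x y => q (x + y) - q x - q y).

(* [act m r s] stands for m (r (x) s).  By the universal property of the tensor
   product over Z, a right R (x) R-module structure on M is the same thing as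
   such an operation. *)
Definition tensor_module (R : nzRingType) (M : zmodType)
    (act : M -> R -> R -> M) : Prop :=
  [/\ forall m m' r s, act (m + m') r s = act m r s + act m' r s,
      forall m, biadditive (act m),
      forall m, act m 1 1 = m &
      forall m r s r' s', act (act m r s) r' s' = act m (r * r') (s * s')].

(* [q phi r] stands for phi[r]; sums in End(Phi) are pointwise. *)
Definition qmodule (R : nzRingType) (Phi : zmodType) (q : Phi -> R -> Phi) :
    Prop :=
  [/\ forall phi phi' r, q (phi + phi') r = q phi r + q phi' r,
      forall phi, pointed_quadratic (q phi),
      forall phi, q phi 1 = phi &
      forall phi r s, q phi (r * s) = q (q phi r) s].

Definition is_unit (R : nzRingType) (r : R) : Prop :=
  exists s, r * s = 1 /\ s * r = 1.

Record formRing := FormRing {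
  frR :> nzRingType;
  frM : zmodType;
  frPhi : zmodType;
  tact : frM -> frR -> frR -> frM;
  qact : frPhi -> frR -> frPhi;
  psi : {additive frR -> frM};
  psiV : frM -> frR;
  tau : {additive frM -> frM};
  dbl : {additive frM -> frPhi};   (* m |-> {{m}} *)
  lam : {additive frPhi -> frM};
  tact_module : tensor_module tact;
  qact_qmodule : qmodule qact;
  psiM : forall r s, psi (r * s) = tact (psi r) 1 s;
  psiK : cancel psi psiV;
  psiVK : cancel psiV psi;
  tauK : involutive tau;
  tau_tact : forall m r s, tact (tau m) s r = tau (tact m r s);
  eps_unit : is_unit (psiV (tau (psi 1)));
  dbl_qact : forall m r, dbl (tact m r r) = qact (dbl m) r;
  lam_qact : forall phi r, lam (qact phi r) = tact (lam phi) r r;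
  dbl_tau : forall m, dbl (tau m) = dbl m;
  tau_lam : forall phi, tau (lam phi) = lam phi;
  lam_dbl : forall m, lam (dbl m) = m + tau m;
  dbl_lam : forall phi r s,
    dbl (tact (lam phi) r s) = qact phi (r + s) - qact phi r - qact phi s
}.

Definition fr_J (FR : formRing) (r : FR) : FR := psiV (tact (psi FR 1) r 1).

Definition nonsingular (V : zmodType) (b : V -> V -> QZ) : Prop :=
  (forall g : {additive V -> QZ}, exists! x, forall y, b x y = g y) /\
  (forall g : {additive V -> QZ}, exists! y, forall x, b x y = g x).

Record repData (FR : formRing) := RepData {
  rV : finLmodType FR;
  rM : frM FR -> rV -> rV -> QZ;
  rPhi : frPhi FR -> rV -> QZ
}.

Definition rbeta (FR : formRing) (rho : repData FR) : rV rho -> rV rho -> QZ :=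
  rM (psi FR 1).

Definition finite_rep (FR : formRing) (rho : repData FR) : Prop :=
  [/\ [/\ forall m, biadditive (rM (r := rho) m),
          forall m m' (x y : rV rho), rM (m + m') x y = rM m x y + rM m' x y,
          forall m r s (x y : rV rho),
            rM (tact m r s) x y = rM m (r *: x) (s *: y) &
          forall m (x y : rV rho), rM (tau FR m) x y = rM m y x],
      nonsingular (rbeta (rho := rho)),
      [/\ forall phi, pointed_quadratic (rPhi (r := rho) phi),
          forall phi phi' (x : rV rho),
            rPhi (phi + phi') x = rPhi phi x + rPhi phi' x &
          forall phi r (x : rV rho), rPhi (qact phi r) x = rPhi phi (r *: x)],
      forall m (x : rV rho), rPhi (dbl FR m) x = rM m x x &
      forall phi (x y : rV rho),
        rM (lam FR phi) x y = rPhi phi (x + y) - rPhi phi x - rPhi phi y].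

Definition zmod_subgroup (U : zmodType) (G : set U) : Prop :=
  G 0 /\ forall x y, G x -> G y -> G (x - y).

Definition value_group (FR : formRing) (rho : repData FR) : set QZ :=
  smallest (@zmod_subgroup QZ)
    (fun q => (exists x y : rV rho, q = rbeta x y) \/
              (exists phi (x : rV rho), q = rPhi phi x)).

Definition conductor (FR : formRing) (rho : repData FR) : nat :=
  #|` fset_set (value_group rho)|%fset.

Section Codes.
Variables (FR : formRing) (rho : repData FR).

Definition is_code (C : {set rV rho}) : Prop := submod_closed (mem C).

Definition dual_code (C : {set rV rho}) : {set rV rho} :=
  [set x | [forall c in C, rbeta x c == 0]]%SET.

Definition code_of_type (C : {set rV rho}) : Prop :=
  [/\ is_code C, C = dual_code C & forall phi c, c \in C -> rPhi phi c = 0].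

End Codes.

Definition sum_rep (FR : formRing) (rho : repData FR) (N : nat)
    (a : 'I_N -> int) : repData FR :=
  @RepData FR {ffun 'I_N -> rV rho}
    (fun m x y => \sum_i rM m (x i) (y i) *~ a i)
    (fun phi x => \sum_i rPhi phi (x i) *~ a i).

Section SymmetricIdempotents.
Variable FR : formRing.
Implicit Types e r : FR.

Definition right_ideal e : set FR := fun x => exists r, x = e * r.

Definition right_ideal_iso e e' : Prop :=
  exists f : FR -> FR,
    [/\ forall x, right_ideal e x -> right_ideal e' (f x),
        forall x y, right_ideal e x -> right_ideal e y -> f (x + y) = f x + f y,
        forall x r, right_ideal e x -> f (x * r) = f x * r,
        forall x y, right_ideal e x -> right_ideal e y -> f x = f y -> x = y &
        forall y, right_ideal e' y -> exists2 x, right_ideal e x & f x = y].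

Definition symmetric_idempotent e : Prop :=
  e * e = e /\ right_ideal_iso e (fr_J e).

Definition conjugate e e' : Prop :=
  exists r s, [/\ r * s = 1, s * r = 1 & e' = r * e * s].

(* The choices entering the definition of the Clifford-Weil groups: elements
   u_e, v_e for every symmetric idempotent e, and representatives of the
   conjugacy classes of symmetric idempotents.  They depend only on the form
   ring, so all representations share them. *)
Record cw_choice := CWChoice {
  cw_u : FR -> FR;
  cw_v : FR -> FR;
  cw_rep : set FR;
  cw_uP : forall e, symmetric_idempotent e ->
    exists r, cw_u e = e * r * fr_J e;
  cw_vP : forall e, symmetric_idempotent e ->
    exists r, cw_v e = fr_J e * r * e;
  cw_uvP : forall e, symmetric_idempotent e ->
    cw_u e * cw_v e = e /\ cw_v e * cw_u e = fr_J e;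
  cw_rep_sym : forall e, cw_rep e -> symmetric_idempotent e;
  cw_rep_ex : forall e, symmetric_idempotent e ->
    exists! e', cw_rep e' /\ conjugate e e'
}.

End SymmetricIdempotents.

Definition idem_image (R : nzRingType) (V : finLmodType R) (e : R) : {set V} :=
  [set e *: x | x : V]%SET.

(* exp(2 pi i x) *)
Definition exp2ipi (RR : realType) (x : RR) : RR[i] :=
  cos (2 * pi * x) +i* sin (2 * pi * x).

(* The value does not depend on the representative chosen by [repr]. *)
Definition expQZ (RR : realType) (q : QZ) : RR[i] :=
  exp2ipi (ratr (repr q : rat)).

Definition in_span (K : fieldType) (L : lmodType K) (S : set L) (x : L) : Prop :=
  exists n (c : 'I_n -> K) (s : 'I_n -> L),
    (forall i, S (s i)) /\ x = \sum_i c i *: s i.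

Definition mx_subgroup (F : fieldType) (n : nat) (G : set 'M[F]_n) : Prop :=
  [/\ G 1%:M, forall g h, G g -> G h -> G (g *m h) &
      forall g, G g -> G (invmx g)].

Section CliffordWeil.
Variables (RR : realType) (FR : formRing) (c : cw_choice FR).
Variable rho : repData FR.
Local Notation V := (rV rho).

(* CV is the space of column vectors indexed by the enumeration of V. *)
Definition bvec (w : V) : 'cV[RR[i]]_#|V| := delta_mx (enum_rank w) 0.

(* The operator sending b_w to T w. *)
Definition operator (T : V -> 'cV[RR[i]]_#|V|) : 'M[RR[i]]_#|V| :=
  \matrix_(i, j) T (enum_val j) i 0.

Definition cw_m (r : FR) := operator (fun w => bvec (r *: w)).

Definition cw_d (phi : frPhi FR) :=
  operator (fun w => expQZ RR (rPhi phi w) *: bvec w).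

Definition sqrt_image (e : FR) : RR := Num.sqrt (#|idem_image V e|%:R).

Definition cw_h (e : FR) :=
  operator (fun w => (sqrt_image e)%:C^-1 *:
    \sum_(u in idem_image V e)
      expQZ RR (rbeta u (cw_v c e *: w)) *: bvec (u + (1 - e) *: w)).

Definition clifford_weil : set 'M[RR[i]]_#|V| :=
  smallest (@mx_subgroup _ _)
    (fun g => [\/ exists2 r, is_unit r & g = cw_m r,
                  exists phi, g = cw_d phi |
                  exists2 e, cw_rep c e & g = cw_h e]).

Definition fwe (C : {set V}) : 'cV[RR[i]]_#|V| := \sum_(w in C) bvec w.

End CliffordWeil.

Definition weight_enumerator_conjecture (RR : realType) (FR : formRing)
    (c : cw_choice FR) : Prop :=
  forall rho : repData FR, finite_rep rho ->
  forall x : 'cV[RR[i]]_#|rV rho|,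
    (forall g, clifford_weil c g -> g *m x = x) <->
    in_span (fun y => exists2 C : {set rV rho}, code_of_type C & y = fwe RR C) x.

Definition generates (L : splittingFieldType rat) (S : set L)
    (E : {subfield L}) : Prop :=
  (forall x, S x -> x \in E) /\
  (forall E' : {subfield L}, (forall x, S x -> x \in E') -> (E <= E')%VS).

(* A model of the number field K(rho), with the embedding [nf_iota] into C that
   identifies it with the subfield Q(zeta_f) F_1 of C.  Over the prime field,
   being a splitting field just means being a finite normal extension; K(rho)
   is one because it is generated by finitely many square roots and roots of
   unity. *)
Record number_fields (RR : realType) (FR : formRing) (rho : repData FR) :=
    NumberFields {
  nf_K : splittingFieldType rat;
  nf_iota : {rmorphism nf_K -> RR[i]};
  nf_zeta : nf_K;
  nf_sqrt : FR -> nf_K;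
  nf_F1 : {subfield nf_K};
  nf_zetaE : nf_iota nf_zeta = exp2ipi (conductor rho)%:R^-1;
  nf_sqrtE : forall e, symmetric_idempotent e ->
    nf_iota (nf_sqrt e) = (sqrt_image RR rho e)%:C;
  nf_F1E : generates
    (fun x => exists2 e, symmetric_idempotent e & x = nf_sqrt e) nf_F1;
  nf_KE : (<<1; nf_zeta>> * nf_F1)%VS = {:nf_K}%VS
}.

Section ConjugateInvariants.
Variables (RR : realType) (FR : formRing) (c : cw_choice FR).
Variables (rho : repData FR) (nf : number_fields RR rho).
Local Notation K := (nf_K nf).
Local Notation V := (rV rho).
Local Notation zeta := (nf_zeta nf).
Local Notation F1 := (nf_F1 nf).

Definition is_complement (F : {subfield K}) : Prop :=
  [/\ (F <= F1)%VS, (F * (F1 :&: <<1; zeta>>))%VS = F1 &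
      (F :&: <<1; zeta>>)%VS = 1%VS].

Variable F : {subfield K}.

Definition gamma (a : int) : gal_of {:K} :=
  odflt 1%g [pick s in 'Gal({:K} / F)%g | s zeta == zeta ^ a].

Definition eps (e : FR) (a : int) : int :=
  if gamma a (nf_sqrt nf e) == nf_sqrt nf e then 1 else -1.

Definition sign_condition (N : nat) (a : 'I_N -> int) : Prop :=
  forall e, symmetric_idempotent e -> \prod_i eps e (a i) = 1.

Variables (n : nat) (alpha : 'I_n -> gal_of {:K}).

(* Functions on K^V, the space of row vectors indexed by the enumeration of V.
   The coordinate x_w of k is [k 0 (enum_rank w)]. *)
Definition conj_coord (w : V) (j : 'I_n) : 'rV[K]_#|V| -> K^o :=
  fun k => alpha j (k 0 (enum_rank w)).

Definition conj_monomial (m : 'I_n -> V -> nat) : 'rV[K]_#|V| -> K^o :=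
  fun k => \prod_j \prod_w conj_coord w j k ^+ m j w.

Definition conj_poly (d : 'I_n -> nat) : set ('rV[K]_#|V| -> K^o) :=
  in_span (fun p => exists2 m, (forall j, (\sum_w m j w)%N = d j) &
                               p = conj_monomial m).

(* The matrices of the elements of the Clifford-Weil group have entries in K. *)
Definition clifford_weil_K : set 'M[K]_#|V| :=
  fun g => clifford_weil c (map_mx (nf_iota nf) g).

Definition cw_invariant (p : 'rV[K]_#|V| -> K^o) : Prop :=
  forall g, clifford_weil_K g -> forall k, p (k *m invmx g) = p k.

Variables (N : nat) (a : 'I_N -> int).

Definition index_set (j : 'I_n) : {set 'I_N} :=
  [set i | gamma (a i) == alpha j]%SET.

Definition ccwe (C : {set {ffun 'I_N -> V}}) : 'rV[K]_#|V| -> K^o :=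
  fun k => \sum_(w in C) \prod_j \prod_(i in index_set j) conj_coord (w i) j k.

End ConjugateInvariants.

(* Main.v *)
(* For gamma_i := gamma(a_i), the functions k |-> prod_i gamma_i(k_{w_i}), w in
   V^N, span K[x o Gamma]_d, so this space is a quotient of the module K V^N.
   The sign condition makes g |-> gamma_1(g) (x) ... (x) gamma_N(g) carry the
   generators of C(rho) to those of C(rho^a), and the quotient map intertwines
   the two actions and sends fwe(C) to ccwe(C).  Hence every ccwe(C) is
   invariant.  Conversely, C(rho^a) acts unitarily on C V^N, so the kernel of
   the quotient map has an invariant complement, and an invariant polynomial p
   lifts to a fixed vector; by the Weight Enumerator Conjecture for rho^a this
   vector is a combination of the fwe(C).  So p is a C-linear combination of
   the ccwe(C), and since all functions involved have values in K, also a
   K-linear one.  The existence of gamma(a) rests on the irreducibility of the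
   cyclotomic polynomials and on F meeting Q(zeta_f) only in Q. *)
From HB Require Import structures.
Require Import Defs.
From mathcomp Require Import all_boot all_order all_fingroup all_algebra all_field.
From mathcomp Require Import generic_quotient finmap complex.
From mathcomp Require Import classical_sets functions cardinality boolp.
From mathcomp Require Import reals trigo ring lra.

Set Implicit Arguments.
Unset Strict Implicit.
Unset Printing Implicit Defensive.

Import Order.TTheory GRing.Theory Num.Theory.

Local Open Scope ring_scope.

(** * The character exp(2 pi i x) of Q/Z *)

Section RootsOfUnity.
Local Open Scope quotient_scope.
Local Open Scope complex_scope.
Variable RR : realType.
Implicit Types (q : QZ) (x y : RR).

Lemma exp2ipiD x y : exp2ipi (x + y) = exp2ipi x * exp2ipi y.
Proof.
rewrite /exp2ipi mulrDr cosD sinD; apply/eqP; rewrite eq_complex /= eqxx /=.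
by apply/eqP; rewrite addrC.
Qed.

Lemma exp2ipi_int (z : int) : exp2ipi (z%:~R : RR) = 1.
Proof.
have exp1 : exp2ipi (1 : RR) = 1.
  by rewrite /exp2ipi mulr1 mulr_natl cos2pi sin2pi.
have nat1 (m : nat) : exp2ipi (m%:R : RR) = 1.
  elim: m => [|m IH]; first by rewrite /exp2ipi mulr0 cos0 sin0.
  by rewrite -addn1 natrD exp2ipiD IH exp1 mulr1.
case: z => m; first exact: nat1.
by have := exp2ipiD (Negz m)%:~R m.+1%:R; rewrite NegzE mulrNz addNr nat1 mulr1
  -[0]/(0%:R) nat1.
Qed.

(** By the double angle formula cos(2 pi x) = 1 forces sin(pi x) = 0, but the sine is positive on
    the open interval from 0 to pi. *)
Lemma exp2ipi_eq1 x : 0 <= x < 1 -> exp2ipi x = 1 -> x = 0.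
Proof.
move=> /andP[x0 x1] [cos1 _]; apply/eqP; case: eqVneq => // xN0; exfalso.
have pix : 0 < pi * x < pi.
  have pi0 := pi_gt0 RR; rewrite gtr_pMr // x1 mulr_gt0 //.
  by rewrite lt_def xN0.
have := sin_gt0_pi pix; rewrite lt_def => /andP[/eqP sinN0 _]; apply: sinN0.
apply/eqP; rewrite -sqrf_eq0 sin2cos2.
have : cos ((pi * x) *+ 2) = 1 by rewrite -mulr_natl mulrA.
by rewrite cos_mulr2n => h; apply/eqP; lra.
Qed.

Lemma pi_QZ_eq (r s : rat) :
  (\pi_QZ r == \pi_QZ s) = (r - s \is a Num.int).
Proof. exact/esym/Quotient.idealrBE. Qed.

(** Representatives of one class differ by an integer, where [exp2ipi] is 1, so the choice made by
    [repr] drops out. *)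
Lemma expQZ_pi (r : rat) : expQZ RR (\pi_QZ r) = exp2ipi (ratr r).
Proof.
have : \pi_QZ (repr (\pi_QZ r)) == \pi_QZ r by rewrite reprK.
rewrite pi_QZ_eq /expQZ => /intrP[z rE].
rewrite -[repr _](subrK r) rE rmorphD /= exp2ipiD ratr_int exp2ipi_int mul1r //.
Qed.

Lemma expQZD q q' : expQZ RR (q + q') = expQZ RR q * expQZ RR q'.
Proof.
rewrite -[q]reprK -[q']reprK -(pi_addr (s := QZ)) !expQZ_pi.
by rewrite rmorphD exp2ipiD.
Qed.

Lemma expQZ0 : expQZ RR 0 = 1.
Proof.
have -> : (0 : QZ) = \pi_QZ 0 by rewrite piE.
by rewrite expQZ_pi rmorph0 -[0]/(0%:~R) exp2ipi_int.
Qed.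

Lemma expQZ_neq0 q : expQZ RR q != 0.
Proof.
apply/negP => /eqP h; have := expQZD q (- q).
by rewrite subrr h mul0r expQZ0 => /eqP; rewrite oner_eq0.
Qed.

Lemma expQZN q : expQZ RR (- q) = (expQZ RR q)^-1.
Proof.
apply: (mulfI (expQZ_neq0 q)).
by rewrite -expQZD subrr expQZ0 divff ?expQZ_neq0.
Qed.

Lemma expQZ_sum (I : finType) (q : I -> QZ) :
  expQZ RR (\sum_i q i) = \prod_i expQZ RR (q i).
Proof. exact: (big_morph _ expQZD expQZ0). Qed.

Lemma expQZMn q n : expQZ RR (q *+ n) = expQZ RR q ^+ n.
Proof. by elim: n => [|n IH]; rewrite ?expQZ0 // mulrS expQZD IH exprS. Qed.

Lemma expQZMz q (z : int) : expQZ RR (q *~ z) = expQZ RR q ^ z.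
Proof. by case: z => n; rewrite ?NegzE ?mulrNz ?expQZN expQZMn. Qed.

Lemma expQZ_conj q : (expQZ RR q)^*%C * expQZ RR q = 1.
Proof.
rewrite /expQZ /exp2ipi; set t := 2 * pi * _; rewrite /=.
apply/eqP; rewrite eq_complex /= -(cos2Dsin2 t); apply/andP; split; apply/eqP.
  by ring.
by ring.
Qed.

Lemma expQZ_eq1 q : expQZ RR q = 1 -> q = 0.
Proof.
(* Subtracting the floor gives a representative in [0, 1), where [exp2ipi_eq1] applies. *)
set r := repr q; pose z := Num.floor r.
have qE : q = \pi_QZ (r - z%:~R).
  rewrite -[q]reprK; apply/eqP; rewrite pi_QZ_eq opprB addrC subrK.
  by apply/intrP; exists z.
rewrite qE expQZ_pi => /exp2ipi_eq1 r0.
suff -> : r - z%:~R = 0 by rewrite piE.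
apply/eqP; rewrite -(fmorph_eq0 (@ratr RR)); apply/eqP; apply: r0.
rewrite ler0q -(rmorph1 (@ratr RR)) ltr_rat subr_ge0 ltrBlDl floor_le /=.
by rewrite -[1]/(1%:~R) -intrD floorD1_gt.
Qed.

Lemma exp2ipi_prim_root n : (0 < n)%N ->
  n.-primitive_root (exp2ipi (n%:R^-1 : RR)).
Proof.
move=> n0; have expM (x : RR) m : exp2ipi x ^+ m = exp2ipi (x *+ m).
  elim: m => [|m IH]; first by rewrite -[x *+ 0]/(0%:~R) exp2ipi_int.
  by rewrite exprS IH mulrS exp2ipiD.
have nR0 : n%:R != 0 :> RR by rewrite pnatr_eq0 -lt0n.
have expn1 : exp2ipi (n%:R^-1 : RR) ^+ n = 1.
  by rewrite expM -[_ *+ n]mulr_natl divff // -[1]/(1%:~R) exp2ipi_int.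
(* The exact order m divides n. If it were smaller, m/n would lie in [0, 1) and [exp2ipi_eq1] would
   give m = 0. *)
have [m m_prim m_dvd] := prim_order_exists n0 expn1.
suff nm : n = m by rewrite {1}nm.
apply/eqP; rewrite eqn_leq (dvdn_leq n0 m_dvd) andbT leqNgt; apply/negP => mn.
have := prim_expr_order m_prim; rewrite expM => /exp2ipi_eq1.
rewrite mulrn_wge0 ?invr_ge0 ?ler0n //= -[_ *+ m]mulr_natl.
rewrite ltr_pdivrMr ?ltr0n // mul1r ltr_nat mn => /(_ isT)/eqP.
rewrite mulf_eq0 invr_eq0 (negPf nR0) orbF pnatr_eq0.
by rewrite -leqn0 leqNgt (prim_order_gt0 m_prim).
Qed.

Lemma expQZ_torsion q n : (0 < n)%N -> q *+ n = 0 ->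
  exists k, expQZ RR q = exp2ipi (n%:R^-1 : RR) ^+ k.
Proof.
move=> n0 qn0.
have expq1 : expQZ RR q ^+ n = 1 by rewrite -expQZMn qn0 expQZ0.
by have [k ->] := prim_rootP (exp2ipi_prim_root n0) expq1; exists k.
Qed.

End RootsOfUnity.

(** * Finiteness of the conductor *)

Section FiniteSubgroups.
Local Open Scope quotient_scope.
Local Open Scope classical_set_scope.

Lemma finite_QZ_torsion n : (0 < n)%N -> finite_set [set q : QZ | q *+ n = 0].
Proof.
move=> n0.
apply: (@sub_finite_set _ _
  ((fun k : nat => \pi_QZ (k%:R / n%:R : rat) : QZ) @` `I_n)); last first.
  exact/finite_image/finite_II.
have nN0 : n%:R != 0 :> rat by rewrite pnatr_eq0 -lt0n.
have nzN0 : n%:Z != 0 by rewrite eqz_nat -lt0n.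
move=> q /= qn0; pose r := repr q.
have : \pi_QZ (r * n%:R) == \pi_QZ 0.
  have <- : q *+ n = \pi_QZ (r * n%:R).
    by rewrite mulr_natr raddfMn /= /r reprK.
  by rewrite qn0 piE.
rewrite pi_QZ_eq subr0 => /intrP[z rz].
have zn0 := modz_ge0 z nzN0.
(* Since n r is the integer z, the class of r is that of (z mod n)/n. *)
exists `|(z %% n)%Z|%N.
  by rewrite /= -ltz_nat gez0_abs // ltz_pmod.
rewrite -[q]reprK; apply/eqP; rewrite pi_QZ_eq; apply/intrP.
exists (- (z %/ n)%Z); apply: (mulIf nN0).
have -> : `|(z %% n)%Z|%:R = (z %% n)%Z%:~R :> rat by rewrite pmulrn gez0_abs.
have zE : z%:~R = (z %/ n)%Z%:~R * n%:R + (z %% n)%Z%:~R :> rat.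
  by rewrite -[n%:R]/(n%:Z%:~R) -intrM -intrD -divz_eq.
by rewrite mulrBl divfK // -/r rz zE opprD addrCA subrr addr0 intrN mulNr.
Qed.

(* Translation by x permutes G, so summing over G gives the claim. *)
Lemma fset_subgroup_torsion (U : zmodType) (G : set U) x :
  finite_set G -> zmod_subgroup G -> G x -> x *+ #|` fset_set G|%fset = 0.
Proof.
move=> finG [G0 GB] Gx; set s := fset_set G.
have inG y : (y \in s) = (y \in G) by rewrite in_fset_set.
have GN y : G y -> G (- y) by move=> ?; rewrite -sub0r; apply: GB.
have GD y z : G y -> G z -> G (y + z).
  by move=> Gy Gz; rewrite -[z]opprK; apply/GB/GN.
have ps : perm_eq [seq y + x | y <- s] s.
  apply: uniq_perm; first by rewrite map_inj_uniq ?fset_uniq //; apply: addIr.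
    exact: fset_uniq.
  move=> y; rewrite inG; apply/mapP/idP => [[z]|].
    by rewrite inG !inE => Gz ->; apply: GD.
  by rewrite inE => Gy; exists (y - x); rewrite ?subrK // inG inE; apply: GB.
apply: (addrI (\sum_(y <- s) y)); rewrite addr0 -[RHS](perm_big _ ps) /=.
by rewrite big_map big_split /= big_const_seq count_predT iter_addr_0.
Qed.

End FiniteSubgroups.

Section Representation.
Variables (FR : formRing) (rho : repData FR) (rho_rep : finite_rep rho).
Local Notation V := (rV rho).
Local Notation b := (@rbeta FR rho).

Lemma rM_biadditive m : biadditive (rM (r := rho) m).
Proof. by case: rho_rep => -[]. Qed.

Lemma rMDl m x x' y : rM (r := rho) m (x + x') y = rM m x y + rM m x' y.
Proof. exact: (rM_biadditive m).1. Qed.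

Lemma rMDr m x y y' : rM (r := rho) m x (y + y') = rM m x y + rM m x y'.
Proof. exact: (rM_biadditive m).2. Qed.

Lemma rM0l m y : rM (r := rho) m 0 y = 0.
Proof. by apply: (addrI (rM m 0 y)); rewrite -rMDl !addr0. Qed.

Lemma rM0r m x : rM (r := rho) m x 0 = 0.
Proof. by apply: (addrI (rM m x 0)); rewrite -rMDr !addr0. Qed.

Lemma rMNr m x y : rM (r := rho) m x (- y) = - rM m x y.
Proof. by apply: (addrI (rM m x y)); rewrite -rMDr !subrr rM0r. Qed.

Lemma rMNl m x y : rM (r := rho) m (- x) y = - rM m x y.
Proof. by apply: (addrI (rM m x y)); rewrite -rMDl !subrr rM0l. Qed.

Lemma rMMnl m x y n : rM (r := rho) m (x *+ n) y = rM m x y *+ n.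
Proof. by elim: n => [|n IH]; rewrite ?rM0l // !mulrS rMDl IH. Qed.

Lemma rMMnr m x y n : rM (r := rho) m x (y *+ n) = rM m x y *+ n.
Proof. by elim: n => [|n IH]; rewrite ?rM0r // !mulrS rMDr IH. Qed.

Lemma rM_tact m r s x y :
  rM (r := rho) (tact m r s) x y = rM m (r *: x) (s *: y).
Proof. by case: rho_rep => -[]. Qed.

Lemma rPhi_quadratic phi : pointed_quadratic (rPhi (r := rho) phi).
Proof. by case: rho_rep => _ _ []. Qed.

Lemma rPhi_polar phi x y : rM (lam FR phi) x y =
  rPhi phi (x + y) - rPhi phi x - rPhi (r := rho) phi y.
Proof. by case: rho_rep. Qed.

Lemma rbeta_nonsingular : nonsingular b.
Proof. by case: rho_rep. Qed.

(** By the definition of J and the right linearity of psi, psi(1)(r (x) 1) = psi(r^J) = psi(1)(1 (x)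
    r^J); both sides are values of [rM] at this element. *)
Lemma rbeta_adj r x y : b (r *: x) y = b x (fr_J r *: y).
Proof.
rewrite /rbeta -[x in RHS]scale1r -rM_tact -psiM mul1r /fr_J psiVK.
by rewrite rM_tact scale1r.
Qed.

Lemma mulrn_card_module (x : V) : x *+ #|V| = 0.
Proof.
apply: (addrI (\sum_(y : V) y)); rewrite addr0.
rewrite [RHS](reindex_inj (addIr x)) big_split /=; congr (_ + _).
by rewrite sumr_const.
Qed.

(** Induction by polarization at x and n x; Pascal's rule collects the polar terms. *)
Lemma rPhiMn (phi : frPhi FR) (x : V) n :
  rPhi phi (x *+ n) = rPhi phi x *+ n + rM (lam FR phi) x x *+ 'C(n, 2).
Proof.
elim: n => [|n IH]; first by rewrite !mulr0n addr0 (rPhi_quadratic phi).1.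
have := rPhi_polar phi x (x *+ n).
rewrite -mulrS rMMnr => /esym/eqP; rewrite -addrA -opprD subr_eq => /eqP ->.
by rewrite IH binS bin1 mulrS mulrnDr addrCA [X in _ + X]addrC !addrA.
Qed.

Lemma value_group_subgroup : zmod_subgroup (value_group rho).
Proof.
split=> [G [[G0 _] _] // | x y xG yG G GP].
by case: (GP) => [[_ GB] _]; apply: GB; [apply: xG | apply: yG].
Qed.

Lemma value_group_rbeta x y : value_group rho (b x y).
Proof. by move=> G [_ sG]; apply: sG; left; exists x, y. Qed.

Lemma value_group_rPhi (phi : frPhi FR) (x : V) :
  value_group rho (rPhi (r := rho) phi x).
Proof. by move=> G [_ sG]; apply: sG; right; exists phi, x. Qed.

(** All generators are killed by 2|V|. The factor 2 serves the quadratic maps: for n = 2|V| the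
    binomial coefficient n(n-1)/2 is a multiple of |V|, so the polar term of [rPhiMn] vanishes. *)
Lemma value_group_finite : finite_set (value_group rho).
Proof.
have V0 : (0 < #|V|)%N by apply/card_gt0P; exists 0.
apply: sub_finite_set (finite_QZ_torsion (_ : (0 < #|V| * 2)%N)); last first.
  by rewrite muln_gt0 V0.
move=> q; apply; split.
  by split=> [|x y /= x0 y0]; rewrite /= ?mul0rn // mulrnBl x0 y0 subrr.
move=> _ [[x [y ->]]|[phi [x ->]]] /=.
  by rewrite mulrnA /rbeta -rMMnl mulrn_card_module rM0l mul0rn.
have := rPhiMn phi x (#|V| * 2); rewrite mulrnA mulrn_card_module mul0rn.
rewrite (rPhi_quadratic phi).1 => /esym.
suff -> : rM (lam FR phi) x x *+ 'C(#|V| * 2, 2) = 0 by rewrite addr0.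
rewrite bin2 muln2 -doubleMl doubleK mulrnA.
by rewrite -rMMnl mulrn_card_module rM0l mul0rn.
Qed.

Lemma conductor_gt0 : (0 < conductor rho)%N.
Proof.
rewrite /conductor cardfs_gt0; apply/fset0Pn; exists 0.
by rewrite in_fset_set ?inE //; [apply: value_group_subgroup.1 |
  apply: value_group_finite].
Qed.

Lemma conductor_torsion q : value_group rho q -> q *+ conductor rho = 0.
Proof.
exact: fset_subgroup_torsion value_group_finite value_group_subgroup.
Qed.

End Representation.

(** * The representation rho^a *)

(** With Bezout coefficients u a + v f = 1, multiplication by u undoes multiplication by a on the
    f-torsion. *)
Lemma mulrz_torsion_inv (a f : int) : coprimez a f ->
  exists u : int, forall q : QZ, q *~ f = 0 -> q *~ a *~ u = q.
Proof.
move=> /coprimezP[[u v] /= uv1]; exists u => q qf0.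
by rewrite -mulrzA -[RHS](mulr1z q) -uv1 mulrzDr mulrC [v * f]mulrC
  [q *~ (f * v)]mulrzA qf0 mul0rz addr0 mulrC.
Qed.

Section NonsingularForms.
Variables (V : zmodType) (b : V -> V -> QZ).
Hypothesis b_biadd : biadditive b.

Let additive_fun (h : V -> QZ) : Prop := forall y y', h (y + y') = h y + h y'.

(** Uniqueness of the representing vectors amounts to trivial left and right kernels, and bundled
    additive maps give way to plain functions. In this shape the property can be checked
    coordinatewise for rho^a. *)
Lemma nonsingularP : nonsingular b <->
  [/\ forall h, additive_fun h -> exists x, forall y, b x y = h y,
      forall h, additive_fun h -> exists y, forall x, b x y = h x,
      forall x, (forall y, b x y = 0) -> x = 0 &
      forall y, (forall x, b x y = 0) -> y = 0].
Proof.
have [bl br] := b_biadd.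
have bBl x x' y : b (x - x') y = b x y - b x' y.
  by apply/eqP; rewrite eq_sym subr_eq -bl subrK.
have bBr x y y' : b x (y - y') = b x y - b x y'.
  by apply/eqP; rewrite eq_sym subr_eq -br subrK.
have packadd h : additive_fun h -> exists g : {additive V -> QZ}, g =1 h.
  move=> hD; have hB : zmod_morphism h.
    by move=> x y; apply/eqP; rewrite eq_sym subr_eq -hD subrK.
  pose hM := GRing.isZmodMorphism.Build _ _ h hB.
  by exists (HB.pack h hM : {additive V -> QZ}).
split=> [[bL bR]|[bL bR bl0 br0]]; split.
- move=> h /packadd[g gh]; have [x [xg _]] := bL g.
  by exists x => y; rewrite xg gh.
- move=> h /packadd[g gh]; have [x [xg _]] := bR g.
  by exists x => y; rewrite xg gh.
- move=> x bx0; have [g g0] : exists g : {additive V -> QZ}, g =1 fun=> 0.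
    by apply: packadd => y y'; rewrite addr0.
  have [z [_ zU]] := bL g.
  rewrite -(zU x) ?(zU 0) // => y; rewrite ?bx0 g0 //.
  by rewrite -[0](subrr 0) bBl subrr.
- move=> x bx0; have [g g0] : exists g : {additive V -> QZ}, g =1 fun=> 0.
    by apply: packadd => y y'; rewrite addr0.
  have [z [_ zU]] := bR g.
  rewrite -(zU x) ?(zU 0) // => y; rewrite ?bx0 g0 //.
  by rewrite -[0](subrr 0) bBr subrr.
- move=> g; have [|x xg] := bL g; first exact: raddfD.
  exists x; split=> // x' x'g; apply/subr0_eq/bl0 => y.
  by rewrite bBl xg x'g subrr.
- move=> g; have [|x xg] := bR g; first exact: raddfD.
  exists x; split=> // x' x'g; apply/subr0_eq/br0 => y.
  by rewrite bBr xg x'g subrr.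
Qed.

End NonsingularForms.

Section SumRepresentation.
Variables (FR : formRing) (rho : repData FR) (rho_rep : finite_rep rho).
Variables (N : nat) (a : 'I_N -> int).
Hypothesis a_prime : forall i, coprimez (a i) (conductor rho).
Local Notation V := (rV rho).
Local Notation W := (rV (sum_rep rho a)).
Local Notation co := (fun (x : W) i => (x : {ffun 'I_N -> V}) i).

Lemma sum_repD (x y : W) i : co (x + y) i = co x i + co y i.
Proof. by rewrite /= ffunE. Qed.

Lemma sum_repN (x : W) i : co (- x) i = - co x i.
Proof. by rewrite /= ffunE. Qed.

Lemma sum_repZ (r : FR) (x : W) i : co (r *: x) i = r *: co x i.
Proof. by rewrite /= ffunE. Qed.

Lemma sum_rep0 i : co 0 i = 0.
Proof. by rewrite /= ffunE. Qed.

Lemma sum_rep_rM_biadditive m : biadditive (rM (r := sum_rep rho a) m).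
Proof.
split=> [x x' y|x y y']; rewrite /= -big_split /=; apply: eq_bigr => i _.
  by rewrite sum_repD rMDl // mulrzDl.
by rewrite sum_repD rMDr // mulrzDl.
Qed.

Lemma sum_rep_rbetaE (x y : W) :
  rbeta (rho := sum_rep rho a) x y = \sum_i rbeta (co x i) (co y i) *~ a i.
Proof. by []. Qed.

Let inj i (v : V) : W := [ffun j => if j == i then v else 0].

Let injD i (v v' : V) : inj i (v + v') = inj i v + inj i v'.
Proof.
by apply/ffunP => j; rewrite sum_repD !ffunE; case: ifP; rewrite ?addr0.
Qed.

Let sum_inj (y : W) : y = \sum_i inj i (co y i).
Proof.
have co_sum (I : Type) (s : seq I) (F : I -> W) j :
    co (\sum_(i <- s) F i) j = \sum_(i <- s) co (F i) j.
  apply: (big_morph (fun z => co z j)) => [z z'|]; first exact: sum_repD.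
  exact: sum_rep0.
apply/ffunP => j; rewrite -/(co _ j) co_sum (bigD1 j) //= ffunE eqxx.
rewrite big1 ?addr0 //.
by move=> i ij; rewrite ffunE eq_sym (negPf ij).
Qed.

Let rbeta_injl i v (y : W) :
  rbeta (rho := sum_rep rho a) (inj i v) y = rbeta v (co y i) *~ a i.
Proof.
rewrite /rbeta /= (bigD1 i) //= ffunE eqxx big1 ?addr0 // => j ji.
by rewrite ffunE (negPf ji) rM0l // mul0rz.
Qed.

Let rbeta_injr i v (y : W) :
  rbeta (rho := sum_rep rho a) y (inj i v) = rbeta (co y i) v *~ a i.
Proof.
rewrite /rbeta /= (bigD1 i) //= ffunE eqxx big1 ?addr0 // => j ji.
by rewrite ffunE (negPf ji) rM0r // mul0rz.
Qed.

Lemma rbeta_conductor (x y : V) : rbeta x y *~ conductor rho = 0.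
Proof. exact: (conductor_torsion rho_rep (value_group_rbeta x y)). Qed.

(** A functional on V^N restricts to the i-th summand, where beta represents it by some x_i. The
    twisted form represents it by the vector of the u_i x_i, with u_i inverse to a_i on the
    f-torsion. Kernels are trivial because a_i can be cancelled in each coordinate. *)
Lemma sum_rep_nonsingular : nonsingular (rbeta (rho := sum_rep rho a)).
Proof.
have /(@nonsingularP _ (@rbeta FR rho) (rM_biadditive rho_rep _))
  [bL bR bl0 br0] := rbeta_nonsingular rho_rep.
have [u uP] : exists u : 'I_N -> int, forall i (q : QZ),
    q *~ conductor rho = 0 -> q *~ a i *~ u i = q.
  have /choice[u uP] i := mulrz_torsion_inv (a_prime i).
  by exists u.
have rbMzl x (y : V) z : rbeta (x *~ z) y = rbeta x y *~ z.
  by case: z => n; rewrite /rbeta ?NegzE ?mulrNz ?(rMNl rho_rep) -!pmulrn rMMnl.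
have rbMzr x (y : V) z : rbeta x (y *~ z) = rbeta x y *~ z.
  by case: z => n; rewrite /rbeta ?NegzE ?mulrNz ?(rMNr rho_rep) -!pmulrn rMMnr.
have swap (q : QZ) i : q *~ conductor rho = 0 -> q *~ u i *~ a i = q.
  by move=> q0; rewrite -mulrzA mulrC mulrzA uP.
apply/(@nonsingularP _ (@rbeta FR (sum_rep rho a)) (sum_rep_rM_biadditive _)).
split.
- move=> h hD; have [x xh] : exists x : 'I_N -> V, forall i y,
      rbeta (x i) y = h (inj i y).
    have /choice[x xh] i : exists x, forall y, rbeta x y = h (inj i y).
      by apply: bL => y y'; rewrite injD hD.
    by exists x.
  exists ([ffun i => x i *~ u i] : W) => y.
  have h0 : h 0 = 0 by apply: (addrI (h 0)); rewrite -hD !addr0.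
  rewrite {2}[y]sum_inj (big_morph h hD h0) sum_rep_rbetaE.
  apply: eq_bigr => i _; rewrite ffunE rbMzl swap ?rbeta_conductor //.
- move=> h hD; have [x xh] : exists x : 'I_N -> V, forall i y,
      rbeta y (x i) = h (inj i y).
    have /choice[x xh] i : exists x, forall y, rbeta y x = h (inj i y).
      by apply: bR => y y'; rewrite injD hD.
    by exists x.
  exists ([ffun i => x i *~ u i] : W) => y.
  have h0 : h 0 = 0 by apply: (addrI (h 0)); rewrite -hD !addr0.
  rewrite {2}[y]sum_inj (big_morph h hD h0) sum_rep_rbetaE.
  apply: eq_bigr => i _; rewrite ffunE rbMzr swap ?rbeta_conductor //.
- move=> x x0; apply/ffunP => i; rewrite sum_rep0; apply: bl0 => y.
  by rewrite -(uP i _ (rbeta_conductor _ _)) -rbeta_injr x0 mul0rz.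
- move=> x x0; apply/ffunP => i; rewrite sum_rep0; apply: br0 => y.
  by rewrite -(uP i _ (rbeta_conductor _ _)) -rbeta_injl x0 mul0rz.
Qed.

Lemma sum_rep_finite : finite_rep (sum_rep rho a).
Proof.
have [[_ rMD rMact rMtau] _ [quad rPhiD rPhiact] rdbl rlam] := rho_rep.
split; [split | exact: sum_rep_nonsingular | split | |].
- exact: sum_rep_rM_biadditive.
- move=> m m' x y; rewrite /= -big_split; apply: eq_bigr => i _.
  by rewrite rMD mulrzDl.
- move=> m r s x y; apply: eq_bigr => i _.
  by rewrite rMact !sum_repZ.
- by move=> m x y; apply: eq_bigr => i _; rewrite rMtau.
- move=> phi; have polar (x y : W) :
      rPhi phi (x + y) - rPhi phi x - rPhi phi y = rM (lam FR phi) x y.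
    rewrite /= -!sumrB; apply: eq_bigr => i _.
    by rewrite sum_repD rlam !mulrzBl.
  split; first by apply: big1 => i _; rewrite sum_rep0 (quad phi).1 mul0rz.
  have [l r] := sum_rep_rM_biadditive (lam FR phi).
  by split=> [x x' y|x y y']; rewrite !polar.
- move=> phi phi' x; rewrite /= -big_split; apply: eq_bigr => i _.
  by rewrite rPhiD mulrzDl.
- move=> phi r x; apply: eq_bigr => i _.
  by rewrite rPhiact !sum_repZ.
- by move=> m x; apply: eq_bigr => i _; rewrite rdbl.
- move=> phi x y; rewrite /= -!sumrB; apply: eq_bigr => i _.
  by rewrite sum_repD rlam !mulrzBl.
Qed.

End SumRepresentation.

(** * Linear algebra *)

(** Gaussian elimination with pivots in K: the last function is either zero and dropped, or has a
    nonzero value by which it is eliminated. This brings the complex coefficients supplied by the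
    Weight Enumerator Conjecture back to K. *)
Lemma span_descent (K C : fieldType) (iota : {rmorphism K -> C}) (X : Type)
    r (q : 'I_r -> X -> K) (p : X -> K) (c : 'I_r -> C) :
  (forall x, iota (p x) = \sum_i c i * iota (q i x)) ->
  exists e : 'I_r -> K, forall x, p x = \sum_i e i * q i x.
Proof.
elim: r q p c => [|r IH] q p c pE.
  exists (fun=> 0) => x; have := pE x; rewrite !big_ord0 => /eqP.
  by rewrite fmorph_eq0 => /eqP.
have [q0|/existsNP[x0 /eqP qx0]] := pselect (forall x, q ord_max x = 0).
  have [x|e eE] := IH (fun i => q (widen_ord (leqnSn r) i)) p
      (fun i => c (widen_ord (leqnSn r) i)).
    by rewrite pE big_ord_recr /= q0 rmorph0 mulr0 addr0.
  (* [insub] recognizes the first r indices; the last one gets the coefficient 0. *)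
  exists (fun i => if insub (val i) is Some j then e j else 0) => x.
  rewrite big_ord_recr /= q0 mulr0 addr0 eE; apply: eq_bigr => i _.
  by rewrite (_ : insub _ = Some i) //; apply: valK.
(* Eliminate q_r by subtracting from p and the other q_i the multiples of q_r
   that make them vanish at x0. *)
pose w i := widen_ord (leqnSn r) i.
pose s x := q ord_max x / q ord_max x0.
have [x|e eE] := IH (fun i x => q (w i) x - q (w i) x0 * s x)
    (fun x => p x - p x0 * s x) (fun i => c (w i)).
  rewrite rmorphB rmorphM !pE !big_ord_recr /= mulrDl mulr_suml.
  rewrite opprD addrACA [X in _ + X](_ : _ = 0) ?addr0.
    rewrite -sumrB; apply: eq_bigr => i _.
    by rewrite -mulrA -mulrBr -rmorphM -rmorphB.
  by rewrite -mulrA -mulrBr -rmorphM /s mulrCA divff // mulr1 subrr mulr0.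
(* The coefficient of the last function is forced by the value at [x0], where the reduced functions
   vanish. *)
pose t := (p x0 - \sum_i e i * q (w i) x0) / q ord_max x0.
exists (fun i => if insub (val i) is Some j then e j else t) => x.
rewrite big_ord_recr /= insubF ?ltnn //.
rewrite (eq_bigr (fun i => e i * q (w i) x)); last first.
  by move=> i _; rewrite (_ : insub _ = Some i) //; apply: valK.
have /eqP := eE x; rewrite /= subr_eq => /eqP ->.
rewrite (eq_bigr _ (fun i _ => mulrBr (e i) _ _)) sumrB -addrA; congr (_ + _).
rewrite /t mulrAC -mulrA -/(s x) mulrBl addrC; congr (_ - _).
by rewrite mulr_suml; apply: eq_bigr => i _; rewrite mulrA.
Qed.

(** The family may be infinite, but ranks are bounded by n: a finite subfamily of maximal rank
    cannot gain from any further member, so its span contains them all. *)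
Lemma row_family_span (F : fieldType) (X : Type) n (m : X -> 'rV[F]_n) :
  exists s : seq X, forall x, (m x <= \sum_(k <- s) <<m k>>)%MS.
Proof.
pose A s := (\sum_(k <- s) <<m k>>)%MS.
have exr : exists r, `[< exists s, \rank (A s) = r >].
  by exists (\rank (A [::])); apply/asboolP; exists [::].
have ler r : `[< exists s, \rank (A s) = r >] -> (r <= n)%N.
  by move=> /asboolP[s <-]; exact: rank_leq_row.
case: (ex_maxnP exr ler) => r /asboolP[s rs] rmax; exists s => x.
have le2 : (A s <= A (x :: s))%MS by rewrite /A big_cons addsmxSr.
have le1 : (m x <= A (x :: s))%MS.
  by rewrite /A big_cons (submx_trans _ (addsmxSl _ _)) // genmxE.
apply: submx_trans le1 _; rewrite -(mxrank_leqif_sup le2).2.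
rewrite eqn_leq (mxrank_leqif_sup le2).1 /= rs rmax //.
by apply/asboolP; exists (x :: s).
Qed.

Section UnitaryLift.
Local Open Scope sesquilinear_scope.

(* y is the orthogonal projection of x to the span of the conjugates of the
   m k. *)
Lemma unitary_lift (C : numClosedFieldType) (X : Type) n (m : X -> 'rV[C]_n)
    (x : 'cV[C]_n) :
  exists2 y : 'cV[C]_n, forall k, m k *m y = m k *m x &
    forall G : 'M[C]_n, G \is unitarymx ->
      (forall k, exists k', m k *m G = m k') ->
      (forall k, m k *m (G *m y) = m k *m y) -> G *m y = y.
Proof.
have [s sP] := row_family_span m; set A := (\sum_(k <- s) _)%MS in sP.
have subA p (B : 'M[C]_(n, p)) : (forall k, m k *m B = 0) -> A *m B = 0.
  move=> mB; apply/sub_kermxP/(big_ind (fun D => (D <= kermx B)%MS)).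
  - exact: sub0mx.
  - by move=> D E DB EB; rewrite addsmx_sub DB.
  - by move=> k _; rewrite genmxE; apply/sub_kermxP.
have Asub p (B : 'M[C]_(n, p)) k : A *m B = 0 -> m k *m B = 0.
  by move=> AB; have /submxP[D ->] := sP k; rewrite -mulmxA AB mulmx0.
have tC p q o (B : 'M[C]_(p, q)) (D : 'M[C]_(q, o)) :
    (B *m D)^t* = D^t* *m B^t* by rewrite trmx_mul map_mxM.
have tB (B D : 'cV[C]_n) : (B - D)^t* = B^t* - D^t*.
  by rewrite linearB map_mxB.
pose y := (x^t* *m proj_ortho A)^t*.
have yA : (y^t* <= A)%MS by rewrite trmxCK proj_ortho_sub.
have yxA : A *m (x - y) = 0.
  have /orthomx1P h : (x^t* - y^t* <= orthomx Num.conj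
      (mx_of_hermitian (hermitian1mx _)) A)%MS.
    by rewrite trmxCK proj_ortho_compl_sub.
  by rewrite -[LHS]trmxCK trmx_mul map_mxM /= tB h !linear0 map_mx0.
exists y => [k|G Gu mG mGy].
  by apply/esym/subr0_eq; rewrite -mulmxBr Asub.
have Gunit := unitarymx_unit Gu.
have AG : (A *m G <= A)%MS.
  rewrite /A; apply: (big_ind (fun D : 'M_n => (D *m G <= A)%MS)).
  - by rewrite mul0mx sub0mx.
  - move=> D E DA EA; rewrite (eqmxMr _ (addsmxE _ _)) mul_col_mx col_mx_sub.
    by rewrite DA.
  - move=> k _; rewrite (eqmxMr _ (genmxE _)).
    by have [k' ->] := mG k; apply: sP.
(* [A *m G] has the rank of [A], so the inclusion just proved is an equality, and the inverse of G
   preserves the row space too. *)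
have AG' : (A *m invmx G <= A)%MS.
  have : (A <= A *m G)%MS.
    rewrite -(mxrank_leqif_sup AG).2 mxrankMfree // row_free_unit //.
  by move=> /(submxMr (invmx G)); rewrite mulmxK.
(* The conjugate transpose of [G *m y - y] lies in the row space of [A], because unitarity turns
   that of [G *m y] into [y^t* *m invmx G]. It is also orthogonal to [A], since G y and y have the
   same products with all [m k]; hence it is 0. *)
apply/subr0_eq/trmx_inj/(map_mx_inj (f := Num.conj)); rewrite linear0 map_mx0.
apply/eqP; rewrite -submx0 -[X in (_ <= X)%MS](orthomx_ortho_disj A).
rewrite sub_capmx; apply/andP; split.
  rewrite tB tC -invmx_unitary // addmx_sub ?eqmx_opp //.
  have /submxP[D ->] := yA; rewrite -mulmxA.
  exact: submx_trans (submxMl _ _) AG'.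
apply/orthomx1P; rewrite -[A]trmxCK -tC trmxCK.
rewrite subA ?linear0 ?map_mx0 // => k.
by rewrite mulmxBr mGy subrr.
Qed.

End UnitaryLift.

(** * Galois conjugates of roots of unity *)

Section CyclotomicConjugates.
Variable L : splittingFieldType rat.
Local Notation "p ^%L" := (map_poly (in_alg L) p) (at level 2, format "p ^%L").
Local Notation "p ^%C" := (map_poly (ratr : rat -> algC) p)
  (at level 2, format "p ^%C").

Lemma minPoly1_rat (z : L) : exists q : {poly rat}, minPoly 1 z = q^%L.
Proof.
have aP i : (minPoly 1 z)`_i \in 1%VS.
  by apply/polyOverP; apply: minPolyOver.
have a_ i := sig_eqW (vlineP _ _ (aP i)).
exists (\poly_(i < size (minPoly 1 z)) sval (a_ i)).
apply/polyP => i; rewrite coef_map coef_poly /=.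
case: ltnP => [_|h]; first by case: (a_ i).
by rewrite nth_default // scale0r.
Qed.

Lemma polyOver1_rat (r : {poly rat}) : r^%L \is a polyOver 1%VS.
Proof. by apply/polyOverP => i; rewrite coef_map /= memvZ ?memv_line. Qed.

(* z and y have the same minimal polynomial over Q. *)
Lemma algC_root_transfer (z : L) : exists y : algC,
  forall r : {poly rat}, root r^%L z = root r^%C y.
Proof.
have [q qE] := minPoly1_rat z.
have sq : size q^%C != 1%N.
  rewrite size_map_poly -(size_map_poly (in_alg L)) -qE.
  have := root_size_gt1 (monic_neq0 (monic_minPoly 1 z)) (root_minPoly 1 z).
  by case: (size _) => [|[]].
have /closed_rootP[y qy] := sq; exists y => r; apply/idP/idP => [rz|ry].
  have := minPoly_dvdp (polyOver1_rat r) rz.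
  rewrite qE dvdp_map => /dvdpP[s ->].
  by rewrite rmorphM rootM qy orbT.
(* Conversely, q and r share the root y, so their gcd is not constant. It divides the irreducible
   minimal polynomial of z, hence is associated to it and vanishes at z. *)
have dz : size (gcdp q r) != 1%N.
  rewrite -(size_map_poly (ratr : {rmorphism rat -> algC})) gcdp_map.
  have : root (gcdp q^%C r^%C) y by rewrite root_gcd qy.
  case: eqVneq => // /eqP/size_poly1P[c c0 ->].
  by rewrite rootC (negPf c0).
have /orP[] : ((gcdp q r)^%L %= minPoly 1 z) || ((gcdp q r)^%L %= 1).
- apply: minPoly_irr; first exact: polyOver1_rat.
  by rewrite qE dvdp_map dvdp_gcdl.
- move=> /eqp_root dE; have : root (gcdp q r)^%L z by rewrite dE root_minPoly.
  by rewrite gcdp_map root_gcd => /andP[].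
move=> /eqp_size; rewrite size_map_poly size_poly1 => /eqP.
by rewrite (negPf dz).
Qed.

(** Over [algC] an automorphism raises n-th roots of unity to the k-th power and permutes the roots
    of rational polynomials; the irreducibility of cyclotomic polynomials enters here. The result
    returns to L by comparing the roots y and z of q(X^k). *)
Lemma root_minPoly1_exp (z : L) n k :
  z ^+ n = 1 -> coprime k n -> root (minPoly 1 z) (z ^+ k).
Proof.
move=> zn1 kn; have [q qE] := minPoly1_rat z.
have [y yE] := algC_root_transfer z.
have yn1 : y ^+ n = 1.
  have := yE ('X^n - 1).
  rewrite !rmorphB !rmorph1 /= !map_polyXn /root !hornerE.
  by rewrite zn1 subrr eqxx subr_eq0 => /esym/eqP.
have [u uE] := Qn_aut_exists kn.
have qy : root q^%C y by rewrite -yE -qE root_minPoly.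
have qyk : root q^%C (y ^+ k).
  rewrite -uE // -[q^%C](_ : map_poly u q^%C = _) ?fmorph_root //.
  by rewrite -map_poly_comp; apply: eq_map_poly => a /=; rewrite fmorph_rat.
have := yE (q \Po 'X^k); rewrite !map_comp_poly !map_polyXn /root !horner_comp.
by rewrite !hornerXn -qE -!rootE qyk.
Qed.

(* minPoly F z divides X^n - 1, so its coefficients lie in Q(z) and in F, hence
   in Q: it is the minimal polynomial of z over Q. *)
Lemma gal_prim_root_exp (F : {subfield L}) (z : L) n k :
    n.-primitive_root z -> (F :&: <<1; z>>)%VS = 1%VS -> coprime k n ->
  exists2 s, s \in 'Gal({:L} / F)%g & s z = z ^+ k.
Proof.
move=> zP Fz kn; apply: normalField_root_minPoly (subvf _) (normalFieldf F) _ _.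
  exact: memvf.
have := root_minPoly1_exp (prim_expr_order zP) kn.
suff /minPoly_dvdp/(_ (root_minPoly F z)) : minPoly F z \is a polyOver 1%VS.
  by move=> /dvdpP[s ->]; rewrite rootM => ->; rewrite orbT.
  have zi i : z ^+ i \in <<1; z>>%VS by rewrite rpredX ?memv_adjoin.
  suff overz : minPoly F z \is a polyOver <<1; z>>%VS.
    apply/polyOverP => i; rewrite -Fz memv_cap (polyOverP overz) andbT.
    by rewrite (polyOverP (minPolyOver F z)).
  have : minPoly F z %| \prod_(0 <= i < n) ('X - (z ^+ i)%:P).
    rewrite factor_Xn_sub_1 //; apply: minPoly_dvdp.
      by rewrite rpredB ?rpredX ?polyOverX ?rpred1.
    by rewrite /root !hornerE prim_expr_order ?subrr.
  move=> /dvdp_prod_XsubC[m].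
  rewrite eqp_monic ?monic_minPoly ?monic_prod_XsubC // => /eqP ->.
  by apply: rpred_prod => i _; rewrite polyOverXsubC.
Qed.

End CyclotomicConjugates.

(** * The automorphisms gamma_a of K over F *)

Section Gamma.
Variables (RR : realType) (FR : formRing) (rho : repData FR).
Hypothesis rho_rep : finite_rep rho.
Variables (nf : number_fields RR rho) (F : {subfield nf_K nf}).
Hypothesis F_compl : is_complement F.
Local Notation K := (nf_K nf).
Local Notation iota := (nf_iota nf).
Local Notation zeta := (nf_zeta nf).
Local Notation f := (conductor rho).

Lemma nf_zeta_prim : f.-primitive_root zeta.
Proof.
rewrite -(fmorph_primitive_root iota) nf_zetaE.
exact/exp2ipi_prim_root/(conductor_gt0 rho_rep).
Qed.

Lemma prim_root_exprz (L : fieldType) (z : L) n (a : int) :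
    n.-primitive_root z -> coprimez a n ->
  exists2 k : nat, coprime k n & z ^ a = z ^+ k.
Proof.
move=> zP an; have n0 := prim_order_gt0 zP.
have nz0 : n%:Z != 0 by rewrite eqz_nat -lt0n.
have r0 := modz_ge0 a nz0; exists `|(a %% n)%Z|%N.
  by rewrite /coprime -[n in gcdn _ n]/(`|n%:Z|%N) -[gcdn _ _]/(`|gcdz _ _|%N)
    gcdz_modl.
have z0 : z != 0.
  apply/eqP => z0; have := prim_expr_order zP.
  by rewrite z0 expr0n eqn0Ngt n0 => /esym/eqP; rewrite oner_eq0.
rewrite {1}(divz_eq a n) expfzDr // [_ * n%:Z]mulrC -exprz_exp.
by rewrite -exprnP (prim_expr_order zP) exp1rz mul1r -{1}(gez0_abs r0).
Qed.

Lemma gamma_gal a : gamma F a \in 'Gal({:K} / F)%g.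
Proof. by rewrite /gamma; case: pickP => [s /andP[]//|_] /=; apply: group1. Qed.

(** [gal_prim_root_exp] provides an automorphism over F with this value at zeta, so the [pick] in
    [gamma] succeeds. *)
Lemma gamma_zeta a : coprimez a f -> gamma F a zeta = zeta ^ a.
Proof.
move=> af; have [k kf ak] := prim_root_exprz nf_zeta_prim af.
have [_ _ Fz] := F_compl.
have [s sF sz] := gal_prim_root_exp nf_zeta_prim Fz kf.
rewrite /gamma; case: pickP => [t /andP[_ /eqP]//|/(_ s)].
by rewrite sF sz ak eqxx.
Qed.

(** Elements of the value group are f-torsion, so their exponentials are powers of zeta_f, which
    gamma_a raises to the power a. *)
Lemma expQZ_nf (q : QZ) : value_group rho q ->
  exists2 k : K, iota k = expQZ RR q &
    forall a, coprimez a f -> iota (gamma F a k) = expQZ RR (q *~ a).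
Proof.
move=> /(conductor_torsion rho_rep).
move=> /(expQZ_torsion RR (conductor_gt0 rho_rep))[m qE].
exists (zeta ^+ m) => [|a af]; first by rewrite rmorphXn /= nf_zetaE.
rewrite !rmorphXn /= gamma_zeta // fmorphXz nf_zetaE expQZMz qE.
by rewrite !exprnP !exprz_exp mulrC.
Qed.

(** The square of the root is the integer |eV|, which automorphisms fix, so only the sign can
    change. *)
Lemma eps_sqrt e a : symmetric_idempotent e ->
  gamma F a (nf_sqrt nf e) = (eps F e a)%:~R * nf_sqrt nf e.
Proof.
move=> esym; set s := nf_sqrt nf e.
have s2 : s ^+ 2 = (#|idem_image (rV rho) e|%:R).
  apply: (fmorph_inj iota); rewrite rmorphXn /= nf_sqrtE // rmorph_nat.
  rewrite -rmorphXn /= sqr_sqrtr ?ler0n //; exact: rmorph_nat.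
have : (gamma F a s) ^+ 2 == s ^+ 2 by rewrite -rmorphXn s2 rmorph_nat.
rewrite /eps -/s; case: (eqVneq (gamma F a s) s) => [->|].
  by rewrite mul1r.
by rewrite eqf_sqr => /negPf -> /= /eqP ->; rewrite mulN1r.
Qed.

End Gamma.

(** * Generators of the Clifford-Weil group *)

Section IdempotentImage.
Variables (R : nzRingType) (V : finLmodType R) (e : R).
Hypothesis e_idem : e * e = e.

Lemma idem_imageE (x : V) : (x \in idem_image V e) = (e *: x == x).
Proof.
apply/imsetP/eqP => [[y _ ->]|ex]; first by rewrite scalerA e_idem.
by exists x.
Qed.

Lemma idem_scaleC (x : V) : e *: ((1 - e) *: x) = 0.
Proof. by rewrite scalerA mulrBr mulr1 e_idem subrr scale0r. Qed.

Lemma idem_image_add (x y : V) :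
  e *: y = 0 -> x \in idem_image V e -> x + y \in idem_image V e -> y = 0.
Proof.
move=> ey; rewrite !idem_imageE scalerDr ey addr0 => /eqP -> /eqP xE.
by apply: (addrI x); rewrite addr0.
Qed.

End IdempotentImage.

Section Generators.
Variables (RR : realType) (FR : formRing) (c : cw_choice FR).
Local Open Scope complex_scope.

(** Generators are named by data of the form ring alone, so that one name denotes corresponding
    operators for rho and for rho^a. *)
Inductive cw_index := CwM of FR | CwD of frPhi FR | CwH of FR.

Definition cw_index_ok (t : cw_index) : Prop :=
  match t with CwM r => is_unit r | CwD _ => True | CwH e => cw_rep c e end.

Definition cw_gen (rho : repData FR) (t : cw_index) : 'M[RR[i]]_#|rV rho| :=
  match t with
  | CwM r => cw_m RR rho r
  | CwD phi => cw_d RR rho phi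
  | CwH e => cw_h RR c rho e
  end.

Section Entries.
Variable rho : repData FR.
Local Notation V := (rV rho).

Lemma bvecE (w u : V) : bvec RR w (enum_rank u) 0 = (u == w)%:R.
Proof. by rewrite mxE eqxx andbT (inj_eq enum_rank_inj). Qed.

Lemma cw_mE r (u w : V) :
  cw_m RR rho r (enum_rank u) (enum_rank w) = (u == r *: w)%:R.
Proof. by rewrite mxE enum_rankK bvecE. Qed.

Lemma cw_dE phi (u w : V) :
  cw_d RR rho phi (enum_rank u) (enum_rank w) =
  if u == w then expQZ RR (rPhi phi w) else 0.
Proof.
by rewrite mxE enum_rankK mxE bvecE; case: eqP => _; rewrite ?mulr1 ?mulr0.
Qed.

(** Only the summation index u - (1 - e) w can contribute to the coefficient of b_u in the image of
    b_w. *)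
Lemma cw_hE e (u w : V) :
  cw_h RR c rho e (enum_rank u) (enum_rank w) =
  (sqrt_image RR rho e)%:C^-1 *
  if u - (1 - e) *: w \in idem_image V e
  then expQZ RR (rbeta (u - (1 - e) *: w) (cw_v c e *: w)) else 0.
Proof.
rewrite mxE enum_rankK mxE summxE; congr (_ * _).
set y := (1 - e) *: w; case: ifP => uy; last first.
  apply: big1 => x xe; rewrite mxE bvecE.
  case: eqP => [uE|]; last by rewrite mulr0.
  by move: uy; rewrite uE addrK xe.
rewrite (bigD1 (u - y)) //= mxE bvecE subrK eqxx mulr1 big1 ?addr0 // => x.
move=> /andP[_ xu]; rewrite mxE bvecE -subr_eq eq_sym (negPf xu) mulr0 //.
Qed.

End Entries.

Section Unitarity.
Variables (rho : repData FR) (rho_rep : finite_rep rho).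
Local Notation V := (rV rho).
Local Notation bt := (@rbeta FR rho).

Lemma rbeta_inj_r y : (forall x, bt x y = 0) -> y = 0.
Proof.
have /(@nonsingularP _ bt (rM_biadditive rho_rep _))[_ _ _ b0] :=
  rbeta_nonsingular rho_rep.
exact: b0.
Qed.

(** Orthogonality of characters on eV. If the character of y were trivial, moving e^J across beta
    would give beta(z, v_e y) = 0 for all z, so v_e y = 0 and y = u_e v_e y = 0. A point [x0] where
    it is nontrivial scales the sum, by translation, by a factor other than 1. *)
Lemma expQZ_orthogonality e (y : V) : symmetric_idempotent e -> e *: y = y ->
  \sum_(x in idem_image V e) expQZ RR (bt x (cw_v c e *: y)) =
  if y == 0 then #|idem_image V e|%:R else 0.
Proof.
move=> esym ey; have [ee _] := esym.
case: eqP => [->|yN0].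
  under eq_bigr do rewrite scaler0 /rbeta (rM0r rho_rep) expQZ0.
  by rewrite sumr_const.
have [uv vu] := cw_uvP c esym; have [r vE] := cw_vP c esym.
have Jv : fr_J e * cw_v c e = cw_v c e.
  by rewrite -vu -mulrA uv vE -mulrA ee.
have [x0 x0e bx0] : exists2 x0,
    x0 \in idem_image V e & bt x0 (cw_v c e *: y) <> 0.
  apply: contrapT => h; apply: yN0; rewrite -ey -uv -scalerA.
  rewrite (_ : cw_v c e *: y = 0) ?scaler0 //; apply: rbeta_inj_r => z.
  rewrite -Jv -scalerA -rbeta_adj //; apply: contrapT => bz; apply: h.
  by exists (e *: z); rewrite ?idem_imageE // scalerA ee.
set S := \sum_(x in _) _; set q := bt x0 _ in bx0.
have : expQZ RR q * S = S.
  rewrite /S mulr_sumr [RHS](reindex_inj (addrI x0)) /=.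
  apply: eq_big => [x|x _].
    rewrite !idem_imageE // scalerDr.
    move: x0e; rewrite idem_imageE // => /eqP ->.
    by rewrite (inj_eq (addrI x0)).
  by rewrite /rbeta (rMDl rho_rep) expQZD.
move=> /eqP; rewrite -subr_eq0 -{2}[S]mul1r -mulrBl mulf_eq0 subr_eq0.
by case/orP => [/eqP/expQZ_eq1 //|/eqP].
Qed.

Lemma conj_expQZ q : Num.conj (expQZ RR q) = expQZ RR (- q).
Proof.
rewrite expQZN; apply: (mulIf (expQZ_neq0 RR q)).
by rewrite mulVf ?expQZ_neq0 // -[RHS](expQZ_conj RR q).
Qed.

Lemma unitarymx_columns (G : 'M[RR[i]]_#|V|) :
  (forall w w', \sum_u Num.conj (G (enum_rank u) (enum_rank w)) *
                       G (enum_rank u) (enum_rank w') = (w == w')%:R) ->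
  G \is unitarymx.
Proof.
move=> GE; rewrite -trmxC_unitary; apply/unitarymxP/matrixP => i j.
rewrite trmxCK !mxE -(enum_valK i) -(enum_valK j) (inj_eq enum_rank_inj) -GE.
rewrite (reindex (@enum_rank V)) /=; last exact/onW_bij/enum_rank_bij.
by apply: eq_bigr => u _; rewrite !mxE.
Qed.

Lemma cw_gen_unitary t : cw_index_ok t -> cw_gen rho t \is unitarymx.
Proof.
case: t => [r|phi|e] /= ok; apply: unitarymx_columns => w w'.
- have [s [rs sr]] := ok; rewrite (bigD1 (r *: w)) //= !cw_mE eqxx big1.
    rewrite addr0 rmorph1 mul1r (inj_eq (can_inj (g := fun x => s *: x) _)) //.
    by move=> x; rewrite scalerA sr scale1r.
  by move=> u /negPf uw; rewrite cw_mE uw rmorph0 mul0r.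
- rewrite (bigD1 w) //= !cw_dE eqxx big1.
    rewrite addr0; case: eqP => [->|]; last by rewrite mulr0.
    by rewrite conj_expQZ -expQZD addNr expQZ0.
  by move=> u /negPf uw; rewrite cw_dE uw rmorph0 mul0r.
- have esym := cw_rep_sym ok; have [ee _] := esym.
  set s := (sqrt_image RR rho e)%:C.
  have ss : Num.conj s^-1 * s^-1 = #|idem_image V e|%:R^-1.
    rewrite fmorphV /= (_ : Num.conj s = s) -?invfM; last exact: conjc_real.
    by rewrite -rmorphM -expr2 sqr_sqrtr ?ler0n // rmorph_nat.
  rewrite (reindex_inj (addIr ((1 - e) *: w))) /=.
  under eq_bigr => x _ do rewrite !cw_hE addrK rmorphM mulrACA ss.
  rewrite -mulr_sumr; set z := (1 - e) *: (w - w').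
  have zE x : x + (1 - e) *: w - (1 - e) *: w' = x + z.
    by rewrite -addrA -scalerBr.
  under eq_bigr => x _ do rewrite zE.
  (* The vector z lies in the kernel of e, which meets eV only in 0. If z is nonzero, the two
     columns have disjoint supports; if z = 0, then w' - w lies in eV and the inner product is a
     character sum. *)
  have [z0|zN0] := eqVneq z 0; last first.
    rewrite big1 ?mulr0.
      by case: (eqVneq w w') zN0 => // ww'; rewrite /z ww' subrr scaler0 eqxx.
    move=> x _; case: ifP => [xe|_]; last by rewrite rmorph0 mul0r.
    case: ifP => [xze|_]; last by rewrite mulr0.
    have z0 : z = 0 := idem_image_add ee (idem_scaleC ee _) xe xze.
    by rewrite z0 eqxx in zN0.
  have ey : e *: (w' - w) = w' - w.
    apply/eqP; rewrite eq_sym -subr_eq0 -{1}[w' - w]scale1r -scalerBl.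
    by rewrite -[w' - w]opprB scalerN -/z z0 oppr0.
  have -> : \sum_x Num.conj (if x \in idem_image V e then
        expQZ RR (rbeta x (cw_v c e *: w)) else 0) *
      (if x + z \in idem_image V e then
        expQZ RR (rbeta (x + z) (cw_v c e *: w')) else 0) =
      \sum_(x in idem_image V e) expQZ RR (rbeta x (cw_v c e *: (w' - w))).
    rewrite [RHS]big_mkcond; apply: eq_bigr => x _; rewrite z0 addr0.
    case: ifP => _; last by rewrite mulr0.
    rewrite conj_expQZ -expQZD scalerBr /rbeta (rMDr rho_rep) (rMNr rho_rep).
    by rewrite addrC.
  rewrite expQZ_orthogonality // subr_eq0 [w' == w]eq_sym.
  case: eqP => _; last by rewrite mulr0.
  rewrite mulVf // pnatr_eq0 -lt0n; apply/card_gt0P; exists 0.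
  by rewrite idem_imageE // scaler0.
Qed.

End Unitarity.
End Generators.

Section TensorGenerators.
Variables (RR : realType) (FR : formRing) (c : cw_choice FR).
Variables (rho : repData FR) (rho_rep : finite_rep rho).
Variables (nf : number_fields RR rho) (F : {subfield nf_K nf}).
Hypothesis F_compl : is_complement F.
Variables (N : nat) (a : 'I_N -> int).
Hypothesis a_prime : forall i, coprimez (a i) (conductor rho).
Hypothesis a_sign : sign_condition F a.
Local Notation K := (nf_K nf).
Local Notation iota := (nf_iota nf).
Local Notation V := (rV rho).
Local Notation W := (rV (sum_rep rho a)).
Local Notation co := (fun (x : W) i => (x : {ffun 'I_N -> V}) i).
Local Notation gam i := (gamma F (a i)).

Let mx (h : V -> V -> K) : 'M[K]_#|V| :=
  \matrix_(i, j) h (enum_val i) (enum_val j).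

Let mxE' h u w : mx h (enum_rank u) (enum_rank w) = h u w.
Proof. by rewrite mxE !enum_rankK. Qed.

Let map_mx_mx h (G : 'M[RR[i]]_#|V|) :
  (forall u w, iota (h u w) = G (enum_rank u) (enum_rank w)) ->
  map_mx iota (mx h) = G.
Proof.
move=> hG; apply/matrixP => i j.
by rewrite mxE -(enum_valK i) -(enum_valK j) mxE' hG.
Qed.

Lemma prod_if (I : finType) (P : pred I) (E : I -> RR[i]) :
  \prod_i (if P i then E i else 0) = if [forall i, P i] then \prod_i E i else 0.
Proof.
case: ifP => [/forallP Pt|/negbT]; first by apply: eq_bigr => i _; rewrite Pt.
rewrite negb_forall => /existsP[i /negPf Pi].
by rewrite (bigD1 i) //= Pi mul0r.
Qed.

Lemma sum_rep_eqE (x y : W) : (x == y) = [forall i, co x i == co y i].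
Proof.
apply/eqP/forallP => [-> //|xy]; apply/ffunP => i; exact/eqP/xy.
Qed.

Lemma sum_rep_idem_image e (x : W) : e * e = e ->
  (x \in idem_image W e) = [forall i, co x i \in idem_image V e].
Proof.
move=> ee; rewrite idem_imageE // sum_rep_eqE.
by apply: eq_forallb => i; rewrite idem_imageE // sum_repZ.
Qed.

Lemma sum_rep_sqrt_image e : e * e = e ->
  sqrt_image RR (sum_rep rho a) e = sqrt_image RR rho e ^+ N.
Proof.
move=> ee; rewrite /sqrt_image.
rewrite (_ : #|idem_image W e| = (#|idem_image V e| ^ N)%N).
  elim: N => [|m IH]; first by rewrite sqrtr1.
  by rewrite expnS natrM sqrtrM ?ler0n // IH exprS.
rewrite -[N in RHS]card_ord -card_ffun_on; apply: eq_card => x.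
by rewrite sum_rep_idem_image //; apply: eq_forallb.
Qed.

(** The entries of a generator for rho lie in K. There gamma_{a_i} multiplies the arguments of
    characters by a_i and 1/sqrt|eV| by a sign; the form and quadratic maps of rho^a are the
    corresponding sums over i. *)
Lemma cw_gen_tensor t : cw_index_ok c t -> exists2 g : 'M[K]_#|V|,
  map_mx iota g = cw_gen RR c rho t &
  forall u w : W, cw_gen RR c (sum_rep rho a) t (enum_rank u) (enum_rank w) =
    \prod_i iota (gam i (g (enum_rank (co u i)) (enum_rank (co w i)))).
Proof.
have [kq kqE kqg] : exists2 kq : QZ -> K,
    forall q, value_group rho q -> iota (kq q) = expQZ RR q &
    forall q i, value_group rho q -> iota (gam i (kq q)) = expQZ RR (q *~ a i).
  have /choice[kq kqP] q : exists k : K, value_group rho q ->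
      iota k = expQZ RR q /\
      forall i, iota (gam i k) = expQZ RR (q *~ a i).
    have [qG|nq] := pselect (value_group rho q); last by exists 0.
    have [k kE kg] := expQZ_nf rho_rep F_compl qG.
    by exists k => _; split=> // i; rewrite kg.
  by exists kq => [q /kqP[]|q i /kqP[_]].
case: t => [r|phi|e] ok; rewrite /cw_gen.
- exists (mx (fun u w => (u == r *: w)%:R)) => [|u w].
    by apply: map_mx_mx => u w; rewrite cw_mE rmorph_nat.
  rewrite cw_mE sum_rep_eqE.
  transitivity (\prod_i (if co u i == r *: co w i then 1 else 0 : RR[i])).
    rewrite prod_if big1 //.
    rewrite (eq_forallb (fun i => congr1 (eq_op (u i)) (sum_repZ r w i))).
    by case: ifP.
  by apply: eq_bigr => i _; rewrite mxE' !rmorph_nat; case: ifP.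
- exists (mx (fun u w => if u == w then kq (rPhi phi w) else 0)) => [|u w].
    apply: map_mx_mx => u w; rewrite cw_dE; case: ifP => _; last exact: rmorph0.
    by apply: kqE; apply: value_group_rPhi.
  rewrite cw_dE sum_rep_eqE expQZ_sum -prod_if; apply: eq_bigr => i _.
  rewrite mxE'; case: ifP => _; last by rewrite !rmorph0.
  by rewrite kqg //; apply: value_group_rPhi.
- have esym := cw_rep_sym ok; have [ee _] := esym.
  pose s := nf_sqrt nf e.
  have sE : iota s = (sqrt_image RR rho e)%:C%C by rewrite nf_sqrtE.
  exists (mx (fun u w => s^-1 * if u - (1 - e) *: w \in idem_image V e
      then kq (rbeta (u - (1 - e) *: w) (cw_v c e *: w)) else 0)) => [|u w].
    apply: map_mx_mx => u w; rewrite cw_hE rmorphM fmorphV sE; congr (_ * _).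
    case: ifP => _; last exact: rmorph0.
    by apply: kqE; apply: value_group_rbeta.
  rewrite cw_hE sum_rep_idem_image // sum_rep_rbetaE expQZ_sum -prod_if.
  (* The sign condition allows the signs to be inserted: 1/sqrt|eW| becomes the product of the
     conjugates of 1/sqrt|eV|. *)
  transitivity (\prod_i ((eps F e (a i))%:~R * (iota s)^-1) *
    \prod_i (if co (u - (1 - e) *: w) i \in idem_image V e then
      expQZ RR (rbeta (co (u - (1 - e) *: w) i) (co (cw_v c e *: w) i) *~ a i)
      else 0)).
    congr (_ * _); rewrite big_split /= -rmorph_prod /= a_sign //= mul1r.
    by rewrite prodr_const card_ord sE sum_rep_sqrt_image // rmorphXn exprVn.
  rewrite -big_split /=; apply: eq_bigr => i _; rewrite mxE' !rmorphM /=.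
  congr (_ * _).
    rewrite !fmorphV /= eps_sqrt // rmorphM invfM rmorph_int.
    by congr (_ * _); rewrite /eps; case: ifP; rewrite ?invr1 ?invrN1.
  have -> : co (u - (1 - e) *: w) i = co u i - (1 - e) *: co w i.
    by rewrite (sum_repD (a := a)) (sum_repN (a := a)) (sum_repZ (a := a)).
  rewrite (sum_repZ (a := a)); case: ifP => _; last by rewrite !rmorph0.
  by rewrite kqg //; apply: value_group_rbeta.
Qed.

End TensorGenerators.

(** * Conjugate monomials and weight enumerators *)

Section Span.
Variables (K : fieldType) (L : lmodType K).
Implicit Types S T : set L.

Lemma in_span_gen S x : S x -> in_span S x.
Proof.
move=> Sx; exists 1%N, (fun=> 1), (fun=> x); split=> //.
by rewrite big_ord1 scale1r.
Qed.

Lemma in_spanD S x y : in_span S x -> in_span S y -> in_span S (x + y).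
Proof.
move=> [m [c [s [sS ->]]]] [m' [c' [s' [sS' ->]]]].
exists (m + m')%N.
exists (fun i => match fintype.split i with inl j => c j | inr j => c' j end).
exists (fun i => match fintype.split i with inl j => s j | inr j => s' j end).
split=> [i|]; first by case: fintype.split.
rewrite big_split_ord /=; congr (_ + _); apply: eq_bigr => i _.
  by rewrite (unsplitK (inl i)).
by rewrite (unsplitK (inr i)).
Qed.

Lemma in_spanZ S a x : in_span S x -> in_span S (a *: x).
Proof.
move=> [m [c [s [sS ->]]]]; exists m, (fun i => a * c i), s; split=> //.
by rewrite scaler_sumr; apply: eq_bigr => i _; rewrite scalerA.
Qed.

Lemma in_span0 S : in_span S 0.
Proof.
by exists 0%N, (fun=> 0), (fun=> 0); split=> [[]|] //; rewrite big_ord0.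
Qed.

Lemma in_span_trans S T x :
  (forall y, S y -> in_span T y) -> in_span S x -> in_span T x.
Proof.
move=> ST [m [c [s [sS ->]]]]; apply: (big_ind (in_span T)).
- exact: in_span0.
- exact: in_spanD.
- by move=> i _; apply/in_spanZ/ST.
Qed.

End Span.

(** The list containing each v with multiplicity m v is as long as D; reading it alongside an
    enumeration of D defines h on D. *)
Lemma prescribed_fibers (I T : finType) (v0 : T) (D : {set I}) (m : T -> nat) :
  (\sum_v m v)%N = #|D| ->
  exists h : I -> T, forall v, #|[set i in D | h i == v]| = m v.
Proof.
move=> mD; pose s := flatten [seq nseq (m v) v | v <- enum T].
have count_s v : count_mem v s = m v.
  rewrite count_flatten -map_comp sumnE big_map big_enum /= (bigD1 v) //=.
  rewrite count_nseq /= eqxx mul1n big1 ?addn0 // => u /negPf uv.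
  by rewrite count_nseq /= uv mul0n.
have size_s : size s = size (enum D).
  rewrite size_flatten /shape -map_comp sumnE big_map big_enum /= -cardE -mD.
  by apply: eq_bigr => v _; rewrite size_nseq.
pose h i := nth v0 s (index i (enum D)); exists h => v; rewrite -count_s.
have <- : [seq h i | i <- enum D] = s.
  apply: (@eq_from_nth _ v0) => [|k]; rewrite size_map // => kD.
  have [i0 _] : exists i0 : I, True by case: (enum D) kD => // i0; exists i0.
  by rewrite (nth_map i0) // /h index_uniq // enum_uniq.
rewrite count_map -sum1_card -sum1_count big_enum_cond /=.
by apply: eq_bigl => i; rewrite inE.
Qed.

Section Monomials.
Variables (RR : realType) (FR : formRing) (c : cw_choice FR).
Variables (rho : repData FR) (rho_rep : finite_rep rho).
Variables (nf : number_fields RR rho) (F : {subfield nf_K nf}).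
Hypothesis F_compl : is_complement F.
Variables (n : nat) (alpha : 'I_n -> gal_of {:nf_K nf}).
Hypothesis alpha_inj : injective alpha.
Hypothesis alpha_gal : [set alpha j | j : 'I_n]%SET = 'Gal({:nf_K nf} / F)%g.
Variables (N : nat) (a : 'I_N -> int).
Local Notation K := (nf_K nf).
Local Notation iota := (nf_iota nf).
Local Notation V := (rV rho).
Local Notation W := (rV (sum_rep rho a)).
Local Notation co := (fun (x : W) i => (x : {ffun 'I_N -> V}) i).
Local Notation gam i := (gamma F (a i)).
Local Notation D := (index_set F alpha a).

(** The image of the basis vector b_w of K V^N in the space of conjugate polynomials. *)
Definition twisted_monomial (w : W) : 'rV[K]_#|V| -> K^o :=
  fun k => \prod_i gam i (k 0 (enum_rank (co w i))).

(** The tuple [alpha] lists the Galois group without repetition, so the index sets partition the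
    positions, and [J i] is the block of i. *)
Lemma index_set_ex :
  exists J : 'I_N -> 'I_n, forall i j, (i \in D j) = (J i == j).
Proof.
have /choice[J JE] (i : 'I_N) : exists j, alpha j = gam i.
  have : gam i \in [set alpha j | j : 'I_n]%SET by rewrite alpha_gal gamma_gal.
  by case/imsetP => j _ ->; exists j.
by exists J => i j; rewrite inE -JE (inj_eq alpha_inj).
Qed.

Lemma prod_index_set (E : 'I_N -> K) :
  \prod_i E i = \prod_j \prod_(i in D j) E i.
Proof.
have [J JE] := index_set_ex; rewrite (partition_big J predT) //=.
by apply: eq_bigr => j _; apply: eq_bigl => i; rewrite JE.
Qed.

Lemma twisted_monomialE w k : twisted_monomial w k =
  \prod_j \prod_(i in D j) conj_coord alpha (co w i) j k.
Proof.
rewrite /twisted_monomial prod_index_set; apply: eq_bigr => j _.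
by apply: eq_bigr => i; rewrite inE => /eqP ->.
Qed.

Lemma ccweE (C : {set W}) : ccwe F alpha a C = \sum_(w in C) twisted_monomial w.
Proof.
apply/funext => k; rewrite /ccwe fct_sumE; apply: eq_bigr => w _.
by rewrite twisted_monomialE.
Qed.

Lemma twisted_conj_monomial w : twisted_monomial w =
  conj_monomial alpha (fun j v => #|[set i in D j | co w i == v]|%SET).
Proof.
apply/funext => k; rewrite twisted_monomialE; apply: eq_bigr => j _.
rewrite (partition_big (co w) predT) //=; apply: eq_bigr => v _.
rewrite -prodr_const; apply: eq_big => [i|i /andP[_ /eqP ->] //].
by rewrite !inE.
Qed.

(** Within each block the exponents say how often every v must occur; any arrangement with these
    multiplicities gives a suitable w. *)
Lemma conj_monomial_twisted (m : 'I_n -> V -> nat) :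
  (forall j, (\sum_v m j v)%N = #|D j|) ->
  exists w : W, conj_monomial alpha m = twisted_monomial w.
Proof.
move=> mD; have [J JE] := index_set_ex.
have /choice[h hE] j := prescribed_fibers 0 (mD j).
exists ([ffun i => h (J i) i] : W).
rewrite twisted_conj_monomial; apply/funext => k.
apply: eq_bigr => j _; apply: eq_bigr => v _; rewrite -hE; congr (_ ^+ _).
apply: eq_card => i; rewrite !inE ffunE.
by have := JE i j; rewrite inE => ->; case: eqP => // ->.
Qed.

Lemma conj_polyE (d : 'I_n -> nat) p : (forall j, d j = #|D j|) ->
  conj_poly alpha d p <-> in_span (range twisted_monomial) p.
Proof.
move=> dD; split; apply: in_span_trans => q.
  move=> [m mD ->]; apply: in_span_gen.
  have [|w ->] := conj_monomial_twisted (m := m); last by exists w.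
  by move=> j; rewrite mD.
move=> [w _ <-]; apply: in_span_gen; eexists; last exact: twisted_conj_monomial.
move=> j; rewrite dD -sum1_card (partition_big (co w) predT) //=.
by apply: eq_bigr => v _; rewrite -sum1_card; apply: eq_bigl => i; rewrite !inE.
Qed.

(** G is the Kronecker product of the conjugates gamma_{a_i}(g), embedded in C. *)
Definition tensor_mx (g : 'M[K]_#|V|) (G : 'M[RR[i]%C]_#|W|) : Prop :=
  forall u w : W, G (enum_rank u) (enum_rank w) =
    \prod_i iota (gam i (g (enum_rank (co u i)) (enum_rank (co w i)))).

(** Multiplying this row by a vector of C V^N evaluates at k the function that the vector
    represents. *)
Definition monomial_row (k : 'rV[K]_#|V|) : 'rV[RR[i]%C]_#|W| :=
  \row_j iota (twisted_monomial (enum_val j) k).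

Lemma monomial_row_mul k (x : 'cV_#|W|) : (monomial_row k *m x) 0 0 =
  \sum_(w : W) iota (twisted_monomial w k) * x (enum_rank w) 0.
Proof.
rewrite mxE (reindex (@enum_rank W)) /=; last exact/onW_bij/enum_rank_bij.
by apply: eq_bigr => w _; rewrite mxE enum_rankK.
Qed.

(** Each factor of a twisted monomial at k g is a sum over V; expanding the product of these sums
    gives a sum over V^N. *)
Lemma monomial_row_tensor g G k : tensor_mx g G ->
  monomial_row (k *m g) = monomial_row k *m G.
Proof.
move=> gG; apply/rowP => j; rewrite -(enum_valK j); set w : W := enum_val j.
rewrite !mxE enum_rankK (reindex (@enum_rank W)) /=; last first.
  exact/onW_bij/enum_rank_bij.
have mulE i : gam i ((k *m g) 0 (enum_rank (co w i))) =
    \sum_(v : V) gam i (k 0 (enum_rank v)) *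
                 gam i (g (enum_rank v) (enum_rank (co w i))).
  rewrite mxE (reindex (@enum_rank V)) /=; last exact/onW_bij/enum_rank_bij.
  by rewrite rmorph_sum; apply: eq_bigr => v _; rewrite rmorphM.
rewrite /twisted_monomial (eq_bigr _ (fun i _ => mulE i)) bigA_distr_bigA /=.
rewrite rmorph_sum; apply: eq_bigr => u _.
by rewrite gG mxE enum_rankK big_split rmorphM !rmorph_prod.
Qed.

Lemma monomial_row_fwe k (C : {set W}) :
  (monomial_row k *m fwe RR C) 0 0 = iota (ccwe F alpha a C k).
Proof.
rewrite ccweE fct_sumE rmorph_sum mulmx_sumr summxE; apply: eq_bigr => w _.
rewrite monomial_row_mul (bigD1 w) // bvecE eqxx mulr1 -[RHS]addr0.
congr (_ + _); apply: big1 => u /andP[_ /negPf uw].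
by rewrite bvecE uw mulr0.
Qed.

End Monomials.

(** * Matrix groups and induction over the generators of C(rho) *)

Section MatrixGroups.
Variable F : fieldType.

Lemma stabilizer_mx_subgroup n (y : 'cV[F]_n) :
  mx_subgroup (fun g : 'M[F]_n => g *m y = y).
Proof.
split=> [|g h gy hy|g gy]; first exact: mul1mx.
  by rewrite -mulmxA hy gy.
(* On a singular matrix [invmx] is the identity, so that case is the hypothesis itself. *)
have [gU|/negbTE gU] := boolP (g \in unitmx); last by rewrite /invmx gU.
by rewrite -{1}gy mulKmx.
Qed.

Lemma function_stabilizer_mx_subgroup n (T : Type) (p : 'rV[F]_n -> T) :
  mx_subgroup (fun g : 'M[F]_n => forall k, p (k *m g) = p k).
Proof.
split=> [k|g h gp hp k|g gp k]; first by rewrite mulmx1.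
  by rewrite mulmxA hp gp.
have [gU|/negbTE gU] := boolP (g \in unitmx); last by rewrite /invmx gU.
by rewrite -[in RHS](mulmxKV gU k) gp.
Qed.

(** This lets an induction over the complex group C(rho) carry a property of matrices over K. *)
Lemma map_mx_subgroup (E : fieldType) (iota : {rmorphism F -> E}) n
    (G : set 'M[F]_n) :
  mx_subgroup G -> mx_subgroup (fun h => exists2 g, G g & h = map_mx iota g).
Proof.
move=> [G1 GM GV]; split=> [|_ _ [g Gg ->] [h Gh ->]|_ [g Gg ->]].
- by exists 1%:M; rewrite ?map_mx1.
- by exists (g *m h); [apply: GM | rewrite map_mxM].
- by exists (invmx g); [apply: GV | rewrite map_invmx].
Qed.

End MatrixGroups.

Section CliffordWeilGenerators.
Variables (RR : realType) (FR : formRing) (c : cw_choice FR).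
Variable rho : repData FR.

Lemma clifford_weil_gen t :
  cw_index_ok c t -> clifford_weil c (cw_gen RR c rho t).
Proof.
case: t => [r|phi|e] ok G [_ sG]; apply: sG.
- by apply: Or31; exists r.
- by apply: Or32; exists phi.
- by apply: Or33; exists e.
Qed.

Lemma clifford_weil_ind (G : set 'M[RR[i]%C]_#|rV rho|) :
    mx_subgroup G -> (forall t, cw_index_ok c t -> G (cw_gen RR c rho t)) ->
  forall g, clifford_weil c g -> G g.
Proof.
move=> GG Ggen g; apply; split=> // _ [[r rU ->]|[phi ->]|[e eP ->]].
- exact: (Ggen (CwM r)).
- exact: (Ggen (CwD phi)).
- exact: (Ggen (CwH e)).
Qed.

Lemma clifford_weil_invmx (g : 'M[RR[i]%C]_#|rV rho|) :
  clifford_weil c g -> clifford_weil c (invmx g).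
Proof. by move=> gC G GP; case: (GP) => [[_ _ GV] _]; exact: GV (gC G GP). Qed.

End CliffordWeilGenerators.

Theorem theorem6p3 (RR : realType) (FR : formRing) (c : cw_choice FR)
    (rho : repData FR) (rho_rep : finite_rep rho)
    (rho_code : exists2 N0 : nat, (0 < N0)%N &
       exists C : {set rV (sum_rep rho (fun _ : 'I_N0 => 1%:Z))}, code_of_type C)
    (wec : weight_enumerator_conjecture RR c)
    (nf : number_fields RR rho)
    (F : {subfield nf_K nf}) (F_compl : is_complement F)
    (n : nat) (alpha : 'I_n -> gal_of {:nf_K nf})
    (alpha_inj : injective alpha)
    (alpha_gal : [set alpha j | j : 'I_n]%SET = 'Gal({:nf_K nf} / F)%g)
    (N : nat) (a : 'I_N -> int)
    (a_prime : forall i, coprimez (a i) (conductor rho))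
    (a_sign : sign_condition F a)
    (d : 'I_n -> nat) (d_def : forall j, d j = #|index_set F alpha a j|) :
  forall p : 'rV[nf_K nf]_#|rV rho| -> (nf_K nf)^o,
    (conj_poly alpha d p /\ cw_invariant c p) <->
    in_span (fun q : 'rV[nf_K nf]_#|rV rho| -> (nf_K nf)^o =>
               exists2 C : {set rV (sum_rep rho a)},
                 code_of_type C & q = ccwe F alpha a C) p.
Proof.
move=> p; rewrite (conj_polyE alpha_inj alpha_gal p d_def).
have sum_fin := sum_rep_finite rho_rep a_prime.
pose m := @monomial_row RR FR rho nf F N a.
have tensorP t : cw_index_ok c t -> exists g,
    [/\ map_mx (nf_iota nf) g = cw_gen RR c rho t &
        forall k, m (k *m g) = m k *m cw_gen RR c (sum_rep rho a) t].
  move=> /(cw_gen_tensor rho_rep F_compl a_prime a_sign)[g gE gT].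
  by exists g; split=> // k; apply: monomial_row_tensor.
split=> [[pspan pinv]|pspan].
(* x is any preimage of p in C V^N, not yet invariant. *)
- have [x xp] : exists x : 'cV_#|rV (sum_rep rho a)|,
      forall k, (m k *m x) 0 0 = nf_iota nf (p k).
    have [r [e [q [qE ->]]]] := pspan.
    have /choice[w wE] i : exists w, q i = twisted_monomial F (a := a) w.
      by have [w _ <-] := qE i; exists w.
    exists (\sum_i nf_iota nf (e i) *: bvec RR (rho := sum_rep rho a) (w i)).
    move=> k.
    rewrite mulmx_sumr summxE fct_sumE rmorph_sum; apply: eq_bigr => i _.
    rewrite -scalemxAr mxE wE [in RHS]/GRing.scale rmorphM; congr (_ * _).
    rewrite monomial_row_mul (bigD1 (w i)) // bvecE eqxx mulr1 -[RHS]addr0.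
    congr (_ + _); apply: big1 => u /andP[_ /negPf uw].
    by rewrite bvecE uw mulr0.
  (* y still represents p, and is fixed by every unitary matrix that maps rows [m k] to such rows
     and leaves the represented function unchanged. *)
  have [y yx yG] := unitary_lift m x.
  have pgen t g : cw_index_ok c t ->
      map_mx (nf_iota nf) g = cw_gen RR c rho t ->
      forall k, p (k *m g) = p k.
    move=> ok gE k; rewrite -[g in LHS]invmxK; apply: pinv.
    rewrite /clifford_weil_K map_invmx gE.
    by apply: clifford_weil_invmx; apply: clifford_weil_gen.
  have yfix g : clifford_weil c g -> g *m y = y.
    apply: clifford_weil_ind (stabilizer_mx_subgroup y) _ g => t ok.
    have [g [gE gT]] := tensorP t ok.
    apply: yG => [|k|k]; first exact: cw_gen_unitary.
      by exists (k *m g); rewrite gT.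
    rewrite mulmxA -gT !yx; apply/rowP => i; rewrite !ord1 !xp.
    by rewrite (pgen t g).
  have [r [e [q [qE yE]]]] := (wec _ sum_fin y).1 yfix.
  have /choice[C CP] i : exists C : {set rV (sum_rep rho a)},
      code_of_type C /\ q i = fwe RR C.
    by have [C CP ->] := qE i; exists C.
  (* Multiplying the expansion of y by the rows [m k] writes p as a complex combination of the
     [ccwe]; the coefficients then descend to K. *)
  have [|e' e'E] := @span_descent _ _ (nf_iota nf) _ r
      (fun i => ccwe F alpha a (C i)) p e.
    move=> k; rewrite -xp -yx yE mulmx_sumr summxE; apply: eq_bigr => i _.
    rewrite -scalemxAr mxE (CP i).2; congr (_ * _).
    exact: (monomial_row_fwe alpha_inj alpha_gal).
  exists r, e', (fun i => ccwe F alpha a (C i)); split=> [i|].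
    by exists (C i) => //; case: (CP i).
  by apply/funext => k; rewrite fct_sumE e'E.
split.
  apply: in_span_trans pspan => _ [C _ ->].
  rewrite (ccweE alpha_inj alpha_gal); apply: (big_ind (in_span _)).
  - exact: in_span0.
  - exact: in_spanD.
  - by move=> w _; apply: in_span_gen; exists w.
have [r [e [q [qE ->]]]] := pspan.
suff qg i g : clifford_weil_K c g -> forall k, q i (k *m g) = q i k.
  move=> g gC k; rewrite !fct_sumE; apply: eq_bigr => i _.
  congr (_ *: _); apply: qg; rewrite /clifford_weil_K map_invmx.
  exact: clifford_weil_invmx.
have [C Ctype ->] := qE i => gC.
have stab := function_stabilizer_mx_subgroup (ccwe F alpha a C).
(* The induction runs over complex matrices, showing each to be the image of some g' over K that
   fixes [ccwe]; injectivity of the embedding identifies g' with g. *)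
suff [g' g'E /map_mx_inj->] : exists2 g',
    (forall k, ccwe F alpha a C (k *m g') = ccwe F alpha a C k) &
    map_mx (nf_iota nf) g = map_mx (nf_iota nf) g' by [].
apply: (clifford_weil_ind (map_mx_subgroup (nf_iota nf) stab) _ gC) => t ok.
have [h [hE hT]] := tensorP t ok; exists h => // k.
apply: (fmorph_inj (nf_iota nf)).
rewrite -!(monomial_row_fwe alpha_inj alpha_gal) -/(m _) hT -mulmxA.
(* The converse half of the conjecture for rho^a: [fwe RR C] is fixed by the generators. *)
rewrite ((wec _ sum_fin (fwe RR C)).2 _ _ (clifford_weil_gen ok)) //.
by apply: in_span_gen; exists C.
Qed.
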